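(* Let $s\in\mathbb{R}^n$ consist of the first $n$ samples of an ergodic source with mean $0$ and variance $\sigma^2$, independent of a design matrix $A\in\mathbb{R}^{n\times ML}$ with i.i.d. $\mathcal{N}(0,1/n)$ entries, where $L\ln M=nR$. Let $\delta_0,\delta_1,\delta_2>0$ satisfy $\Delta:=\delta_0+5R(\delta_1+\delta_2)<\frac12$. Let $A\hat\beta$ be the codeword produced by the successive cancellation encoder (see context). Then for all sufficiently large $M,L$, $$\mathbb{P}\Big(\frac1n\|s-A\hat\beta\|^2>\sigma^2e^{-2R}(1+e^R\Delta)^2\Big)<p_0+p_1+p_2,$$ where $p_0=\mathbb{P}\big(\big|\frac{\|s\|}{\sqrt n\,\sigma}-1\big|>\delta_0\big)$, $p_1=2ML\exp(-n\delta_1^2/8)$, and $p_2=\big(\frac{8\log M}{M^{2\delta_2}}\big)^L$.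
   Context: Columns of $A$ are $A_1,\dots,A_{ML}$, grouped into $L$ sections of $M$ consecutive columns. Coefficients: $c_\ell=\sqrt{2(\ln M)\sigma^2(1-\frac{2R}{L})^{\ell-1}}$, $\ell\in[L]$. Successive cancellation encoder: $r_0=s$; for $\ell=1,\dots,L$, let $m_\ell=\arg\max_{(\ell-1)M<j\le\ell M}\langle\sqrt n A_j,\,r_{\ell-1}/\|r_{\ell-1}\|\rangle$ and $r_\ell=r_{\ell-1}-c_\ell A_{m_\ell}$. The output $\hat\beta\in\mathbb{R}^{ML}$ has entry $c_\ell$ in position $m_\ell$ for each $\ell$ and zeros elsewhere, so $s-A\hat\beta=r_L$. Rate $R$ is in nats. *)

(* Defs.v *)
From HB Require Import structures.
From mathcomp Require Import all_boot all_order all_algebra.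
From mathcomp Require Import all_classical all_reals all_analysis.
Set Implicit Arguments.
Unset Strict Implicit.
Unset Printing Implicit Defensive.
Import Order.TTheory GRing.Theory Num.Theory.
Local Open Scope classical_set_scope.
Local Open Scope ring_scope.

Section SparseRegressionSource.
Context {R : realType} {d : measure_display} {T : measurableType d}
  (P : probability T R).

(* strict stationarity: all finite-dimensional laws are shift invariant
   (stated on measurable rectangles, which generate the product sigma-algebra) *)
Definition stationary (X : nat -> T -> R) : Prop :=
  forall (n k : nat) (B : nat -> set R), (forall i, measurable (B i)) ->
    P [set w | forall i, (i < n)%N -> B i (X i w)] =
    P [set w | forall i, (i < n)%N -> B i (X (k + i)%N w)].

Definition cylinder_sets : set (set (nat -> R)) :=
  [set C | exists (i : nat) (B : set R), measurable B /\ C = [set u | B (u i)]].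

Definition path_measurable (C : set (nat -> R)) : Prop := <<s cylinder_sets >> C.

Definition shift_invariant (C : set (nat -> R)) : Prop :=
  forall u : nat -> R, C u <-> C (fun i => u i.+1).

Definition ergodic (X : nat -> T -> R) : Prop :=
  forall C, path_measurable C -> shift_invariant C ->
    P [set w | C (fun i => X i w)] = 0%E \/ P [set w | C (fun i => X i w)] = 1%E.

Definition ergodic_source (X : nat -> T -> R) (sigma : R) : Prop :=
  [/\ forall i, measurable_fun setT (X i),
      stationary X, ergodic X,
      forall i, P.-integrable setT (EFin \o X i) /\
                (\int[P]_w (X i w)%:E = 0)%E &
      forall i, P.-integrable setT (fun w => ((X i w) ^+ 2)%:E) /\
                (\int[P]_w ((X i w) ^+ 2)%:E = (sigma ^+ 2)%:E)%E ].

Definition first_samples (X : nat -> T -> R) (n : nat) (w : T) : 'cV[R]_n :=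
  \col_(i < n) X i w.

(* Product rule on measurable rectangles: the entries are mutually
   independent, each with law N(0,1/n) (standard deviation sqrt(1/n)),
   and the family of entries is independent of (X_0,...,X_{n-1}). *)
Definition gaussian_design_indep (X : nat -> T -> R) (n m : nat)
    (Aent : 'I_n -> 'I_m -> T -> R) : Prop :=
  (forall i j, measurable_fun setT (Aent i j)) /\
  forall (B : 'I_n -> 'I_m -> set R) (C : 'I_n -> set R),
    (forall i j, measurable (B i j)) -> (forall i, measurable (C i)) ->
    P ([set w | forall i : 'I_n, C i (X i w)] `&`
       [set w | forall i j, B i j (Aent i j w)]) =
    (P [set w | forall i : 'I_n, C i (X i w)] *
     \prod_(i < n) \prod_(j < m)
        normal_prob 0 (Num.sqrt (n%:R^-1)) (B i j))%E.

Definition design_matrix n m (Aent : 'I_n -> 'I_m -> T -> R) (w : T)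
  : 'M[R]_(n, m) := \matrix_(i, j) Aent i j w.

End SparseRegressionSource.

Section Encoder.
Context {R : realType}.

Definition enorm n (v : 'cV[R]_n) : R := Num.sqrt (\sum_i (v i 0) ^+ 2).

(* coefficient of section l+1 (0-based l):
   c_{l+1} = sqrt(2 (ln M) sigma^2 (1 - 2R/L)^l) *)
Definition sc_coef (M L : nat) (sigma Rt : R) (l : nat) : R :=
  Num.sqrt (2 * ln (M%:R : R) * sigma ^+ 2 * (1 - 2 * Rt / L%:R) ^+ l).

Lemma ordML_proof (M L : nat) (l : 'I_L) (k : 'I_M) : (l * M + k < M * L)%N.
Proof.
case: l k => l Hl [k Hk] /=.
have H1 : (l * M + k < l * M + M)%N by rewrite ltn_add2l.
apply: (leq_trans H1); by rewrite addnC -mulSn mulnC leq_mul2l Hl orbT.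
Qed.

(* column index of the k-th column (0-based) of section l (0-based) *)
Definition ordML (M L : nat) (l : 'I_L) (k : 'I_M) : 'I_(M * L) :=
  Ordinal (ordML_proof l k).

Definition sc_score n M L (A : 'M[R]_(n, M * L)) (r : 'cV[R]_n)
    (l : 'I_L) (k : 'I_M) : R :=
  \sum_(i < n) (Num.sqrt (n%:R) * A i (ordML l k)) * (r i 0 / enorm r).

Definition sc_step n M L (sigma Rt : R) (A : 'M[R]_(n, M * L))
    (st : 'cV[R]_n * 'cV[R]_(M * L)) (l : 'I_L)
    : 'cV[R]_n * 'cV[R]_(M * L) :=
  let r := st.1 in
  match [pick k : 'I_M | [forall k' : 'I_M, sc_score A r l k' <= sc_score A r l k]] with
  | Some k => (r - sc_coef M L sigma Rt l *: col (ordML l k) A,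
               st.2 + sc_coef M L sigma Rt l *: delta_mx (ordML l k) 0)
  | None => st
  end.

Definition sc_beta n M L (sigma Rt : R) (A : 'M[R]_(n, M * L)) (s : 'cV[R]_n)
  : 'cV[R]_(M * L) :=
  (foldl (sc_step sigma Rt A) (s, 0) (enum 'I_L)).2.

End Encoder.

(* Main.v *)
Require Import Defs.
From HB Require Import structures.
From mathcomp Require Import all_boot all_order all_algebra.
From mathcomp Require Import all_classical all_reals all_analysis.
From mathcomp Require Import measurable_realfun normal_distribution.
From mathcomp Require Import ring lra.
Import Order.TTheory GRing.Theory Num.Theory.
Local Open Scope classical_set_scope.
Local Open Scope ring_scope.
Set Implicit Arguments.
Unset Strict Implicit.
Unset Printing Implicit Defensive.

(** Put [rho = 2 Rt / L], [a = rho / (1 - rho)], let [r_l] be the residual after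
    [l] sections and [D_l = |r_l| / (sqrt n sigma (1 - rho)^(l/2))].  If the column
    selected in section [l] has score [sqrt (2 ln M) (1 - x)] and squared norm
    [1 + g], then
      [(1 - rho) D_(l+1)^2 <= D_l^2 - 2 rho D_l (1 - x) + rho (1 + g)],
    so [E_l = max(D_l, 1) - 1] satisfies [E_(l+1) <= (1 + a/2) E_l + a (x^+ + g^+/2)].
    It remains to bound the probabilities of [sum x^+ > L d2] and [sum g^+ > L d1],
    by Chernoff's method.

    For the norms, [expR (n tau g^+)] is at most [1] plus the sum of the same
    exponential over all columns of the section, whose mean is a chi-square moment.

    For the scores [z_k] of a section, with [u = sqrt (2 ln M)] and [t = 4 ln M],
      [expR (t x^+) <= expR (t x0) + expR t * prod_k psi (z_k)],
    where [psi z >= 0] is a combination of four exponentials which dominates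
    [expR (- t z / (M u))] on [z <= u (1 - x0)].  Thus only exponential moments of
    [z_k], a linear form in a fresh Gaussian column along a unit vector depending
    on the past, are needed.  They are computed by integrating out the matrix
    entries one at a time, each being independent of the sigma-algebra generated
    by the source and the previous entries. *)

(** * Gaussian moments and Fubini for a sub-sigma-algebra *)

Section NormalMoments.
Context {R : realType}.
Local Notation mu := (@lebesgue_measure R).

(** The Radon-Nikodym derivative of the normal law and the density [normal_pdf] have the same
    integral over every measurable set, so they agree almost everywhere. *)
Lemma ge0_integral_normal_prob (m s : R) (f : R -> \bar R) :
  measurable_fun setT f -> (forall x, 0 <= f x)%E ->
  (\int[normal_prob m s]_x f x = \int[mu]_x (f x * (normal_pdf m s x)%:E))%E.
Proof.
move=> mf f0.
pose nu : {finite_measure set _ -> \bar R} := normal_prob m s.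
have dom : nu `<< mu := normal_prob_dominates m s.
rewrite -(Radon_Nikodym_SigmaFinite.change_of_variables dom)//.
have mp : measurable_fun setT (fun x : R => (normal_pdf m s x)%:E).
  by apply/measurable_EFinP; exact: measurable_normal_pdf.
have intf := Radon_Nikodym_SigmaFinite.f_integrable dom.
apply: ae_eq_integral => //.
- by apply: emeasurable_funM => //; exact: measurable_int intf.
- exact: emeasurable_funM.
- apply: ae_eqe_mul2l; apply: integral_ae_eq => //=.
  by move=> E _ mE; rewrite -Radon_Nikodym_SigmaFinite.f_integral.
Qed.

Lemma normal_prob_mgf (s a : R) : 0 < s ->
  (\int[normal_prob 0 s]_x (expR (a * x))%:E = (expR (a ^+ 2 * s ^+ 2 / 2))%:E)%E.
Proof.
move=> s0; have sn0 : s != 0 by rewrite gt_eqF.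
rewrite ge0_integral_normal_prob; last 2 first.
- by apply/measurable_EFinP; apply: measurableT_comp => //; exact: mulrl_measurable.
- by move=> x; rewrite lee_fin expR_ge0.
(* Completing the square: the exponential tilt only moves the mean to [a * s ^+ 2]. *)
transitivity (\int[mu]_x ((expR (a ^+ 2 * s ^+ 2 / 2))%:E *
    (normal_pdf (a * s ^+ 2) s x)%:E))%E.
  apply: eq_integral => x _; rewrite -!EFinM; congr EFin.
  rewrite !normal_pdfE// !mulrA ![_ * normal_peak s]mulrC -!mulrA; congr (_ * _).
  rewrite /normal_fun -!expRD; congr expR.
  by field.
rewrite ge0_integralZl//; last 2 first.
- by apply/measurable_EFinP; exact: measurable_normal_pdf.
- by move=> x _; rewrite lee_fin normal_pdf_ge0.
by rewrite integral_normal_pdf mule1.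
Qed.

Lemma normal_prob_sqr_mgf (s b : R) : 0 < s -> 2 * b * s ^+ 2 < 1 ->
  (\int[normal_prob 0 s]_x (expR (b * x ^+ 2))%:E =
   ((Num.sqrt (1 - 2 * b * s ^+ 2))^-1)%:E)%E.
Proof.
move=> s0 hb; have sn0 : s != 0 by rewrite gt_eqF.
rewrite ge0_integral_normal_prob; last 2 first.
- apply/measurable_EFinP; apply: measurableT_comp => //.
  by apply: measurable_funM => //; exact: exprn_measurable.
- by move=> x; rewrite lee_fin expR_ge0.
set w := Num.sqrt _.
have w0 : 0 < w by rewrite sqrtr_gt0; lra.
have w2 : w ^+ 2 = 1 - 2 * b * s ^+ 2 by rewrite sqr_sqrtr//; lra.
have sw0 : s / w != 0 by rewrite gt_eqF// divr_gt0.
(* The quadratic tilt leaves a centred Gaussian of standard deviation [s / w]; the ratio of the two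
   peaks is [w^-1]. *)
transitivity (\int[mu]_x ((w^-1)%:E * (normal_pdf 0 (s / w) x)%:E))%E.
  apply: eq_integral => x _; rewrite -!EFinM; congr EFin.
  rewrite !normal_pdfE// mulrA [expR _ * _]mulrC -[LHS]mulrA [RHS]mulrA.
  have -> : normal_peak s = w^-1 * normal_peak (s / w).
    rewrite /normal_peak -invfM; congr (_^-1).
    have -> : s ^+ 2 * pi *+ 2 = w ^+ 2 * ((s / w) ^+ 2 * pi *+ 2).
      by field; rewrite gt_eqF.
    by rewrite sqrtrM ?sqr_ge0// sqrtr_sqr gtr0_norm.
  congr (_ * _); rewrite /normal_fun -!expRD; congr expR.
  have -> : b = (1 - w ^+ 2) / (2 * s ^+ 2) by rewrite w2; field.
  by field; rewrite sn0 gt_eqF.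
rewrite ge0_integralZl//; last 3 first.
- by apply/measurable_EFinP; exact: measurable_normal_pdf.
- by move=> x _; rewrite lee_fin normal_pdf_ge0.
- by rewrite lee_fin invr_ge0 ltW.
by rewrite integral_normal_pdf mule1.
Qed.

End NormalMoments.

Section IndependentFubini.
Context {R : realType} {d : measure_display} {T : measurableType d}
  (P : probability T R) (G : set (set T)).
Let E := g_sigma_algebraType G.
Hypotheses (GI : setI_closed G) (GT : G setT) (Gm : G `<=` measurable).

Lemma sub_g_sigma_measurable (A : set T) : <<s G >> A -> measurable A.
Proof. exact: (smallest_sub (@sigma_algebra_measurable _ T) Gm). Qed.

Lemma measurable_g_sigma_id : measurable_fun setT (id : T -> E).
Proof. by move=> _ A mA; rewrite setTI; exact: sub_g_sigma_measurable. Qed.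

Lemma measurable_g_sigma d' (U : measurableType d') (f : E -> U) :
  measurable_fun setT f -> measurable_fun setT (f : T -> U).
Proof. by move=> mf; exact: (measurableT_comp mf measurable_g_sigma_id). Qed.

(** The first coordinate of [f] is the sample point itself, seen through the sigma-algebra generated
    by [G], so [f] may depend on the whole past. The product rule, assumed on the pi-system [G]
    only, makes the law of [(w, Z w)] a product measure, and Tonelli applies. *)
Lemma integral_indep_sigma d' (U : measurableType d') (Z : T -> U)
    (nu : probability U R) (f : E * U -> \bar R) :
  measurable_fun setT Z ->
  (forall A B, G A -> measurable B -> P (A `&` Z @^-1` B) = (P A * nu B)%E) ->
  measurable_fun setT f -> (forall x, 0 <= f x)%E ->
  (\int[P]_w f (w : E, Z w) = \int[P]_w \int[nu]_z f (w : E, z))%E.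
Proof.
move=> mZ PG mf f0.
have mid := measurable_g_sigma_id.
have mp : measurable_fun setT (fun w : T => (w : E, Z w)).
  exact: measurable_fun_pair.
pose idm : {mfun T >-> E} := HB.pack (id : T -> E) (isMeasurableFun.Build _ _ _ _ _ mid).
pose pm : {mfun T >-> (E * U)%type} :=
  HB.pack (fun w : T => (w : E, Z w)) (isMeasurableFun.Build _ _ _ _ _ mp).
have joint (A : set E) (B : set U) : measurable A -> measurable B ->
    distribution P pm (A `*` B) = (distribution P idm A * nu B)%E.
  move=> mA mB.
  have mZB : measurable (Z @^-1` B) by rewrite -[_ @^-1` _]setTI; exact: mZ.
  have nuf : (nu B) \is a fin_num by exact: fin_num_measure.
  (* For fixed [B], both sides are finite measures in [A] that agree on the pi-system [G], hence on
     the sigma-algebra it generates. *)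
  have key : mrestr P mZB A = mscale (NngNum (fine_ge0 (measure_ge0 nu B))) P A.
    apply: (g_sigma_algebra_measure_unique G Gm (fun=> setT)) => //.
    - by apply: bigcup_const; exists 0%N.
    - move=> C GC.
      change (P (C `&` Z @^-1` B) = (fine (nu B))%:E * P C)%E.
      by rewrite fineK// PG// muleC.
    - move=> _; change (P (setT `&` Z @^-1` B) < +oo)%E.
      by rewrite setTI; apply: le_lt_trans (ltry 1); exact: probability_le1.
  move: key; change (P (A `&` Z @^-1` B) = (fine (nu B))%:E * P A ->
    P (A `&` Z @^-1` B) = P A * nu B)%E.
  by rewrite fineK// muleC.
rewrite -(ge0_integral_distribution pm mf)// -[RHS](ge0_integral_distribution idm (f := fun w => \int[nu]_z f (w, z))%E).
- rewrite -fubini_tonelli1//; apply: eq_measure_integral => A mA _.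
  by apply/esym/product_measure_unique => // A' B mA' mB; exact: joint.
- exact: measurable_fun_fubini_tonelli_F.
- by move=> y; apply: integral_ge0.
Qed.

End IndependentFubini.

(** * The filtration of the matrix entries *)

Section Filtration.
Context {R : realType} {d : measure_display} {T : measurableType d}
  (P : probability T R) (X : nat -> T -> R) (n m : nat)
  (Aent : 'I_n -> 'I_m -> T -> R).

(** The entries are ordered column by column, entry [(i, j)] having rank [j * n + i]; the source and
    the entries of rank below [p] are known. Only rectangles are taken: they form a pi-system on
    which the independence hypothesis can be read off directly. *)
Definition past (p : nat) : set (set T) :=
  [set A | exists (C : 'I_n -> set R) (B : 'I_n -> 'I_m -> set R),
    [/\ forall i, measurable (C i), forall i j, measurable (B i j) &
      A = [set w | forall i : 'I_n, C i (X i w)] `&`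
          [set w | forall (i : 'I_n) (j : 'I_m), (j * n + i < p)%N -> B i j (Aent i j w)]]].

Definition adapted (p : nat) (f : T -> R) : Prop :=
  measurable_fun (setT : set (g_sigma_algebraType (past p))) f.

Lemma past_setI_closed p : setI_closed (past p).
Proof.
move=> _ _ [C1 [B1 [mC1 mB1 ->]]] [C2 [B2 [mC2 mB2 ->]]].
exists (fun i => C1 i `&` C2 i), (fun i j => B1 i j `&` B2 i j); split.
- by move=> i; exact: measurableI.
- by move=> i j; exact: measurableI.
- apply/seteqP; split => w /=.
    move=> [[c1 b1] [c2 b2]]; split; first by move=> i; split.
    by move=> i j ij; split; [exact: b1|exact: b2].
  move=> [c b]; split; split=> //; first by move=> i; case: (c i).
  + by move=> i j ij; case: (b i j ij).
  + by move=> i; case: (c i).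
  + by move=> i j ij; case: (b i j ij).
Qed.

Lemma past_setT p : past p setT.
Proof.
exists (fun=> setT), (fun _ _ => setT); split => //.
by apply/seteqP; split => w /=.
Qed.

Lemma past_widen p q : (p <= q)%N -> past p `<=` past q.
Proof.
move=> pq _ [C [B [mC mB ->]]].
exists C, (fun (i : 'I_n) (j : 'I_m) => if (j * n + i < p)%N then B i j else setT); split => //.
- by move=> i j; case: ifP.
- apply/seteqP; split => w /= [c b]; split => // i j ij.
    by case: ifP => // jp; exact: b.
  by have := b i j (leq_trans ij pq); rewrite ij.
Qed.

Lemma adapted_widen p q f : (p <= q)%N -> adapted p f -> adapted q f.
Proof.
move=> pq mf _ B mB; apply: (sub_sigma_algebra2 (past_widen pq)).
exact: mf.
Qed.

Lemma measurable_past_id p q : (p <= q)%N ->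
  measurable_fun setT (id : g_sigma_algebraType (past q) -> g_sigma_algebraType (past p)).
Proof.
by move=> pq _ B mB; rewrite setTI; exact: (sub_sigma_algebra2 (past_widen pq)).
Qed.

Lemma adapted_source p (i : 'I_n) : adapted p (X i).
Proof.
move=> _ B mB; rewrite setTI; apply: sub_sigma_algebra.
exists (fun i' => if i' == i then B else setT), (fun _ _ => setT); split => //.
- by move=> i'; case: ifP.
- apply/seteqP; split => w /=.
    by move=> h; split => // i'; case: eqP => // ->.
  by move=> [+ _] => /(_ i); rewrite eqxx.
Qed.

Lemma adapted_entry p (i : 'I_n) (j : 'I_m) : (j * n + i < p)%N -> adapted p (Aent i j).
Proof.
move=> ijp _ B mB; rewrite setTI; apply: sub_sigma_algebra.
exists (fun=> setT), (fun i' j' => if (i' == i) && (j' == j) then B else setT); split => //.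
- by move=> i' j'; case: ifP.
- apply/seteqP; split => w /=.
    by move=> h; split => // i' j' _; case: ifP => // /andP[/eqP-> /eqP->].
  by move=> [_ +] => /(_ i j ijp); rewrite !eqxx.
Qed.

Hypothesis mX : forall i, measurable_fun setT (X i).
Hypothesis gd : gaussian_design_indep P X Aent.

Lemma past_measurable p : past p `<=` measurable.
Proof.
move=> _ [C [B [mC mB ->]]].
have mA := gd.1.
have fcap (I : finType) (F : I -> set T) : (forall i, measurable (F i)) ->
    measurable [set w | forall i, F i w].
  move=> mF; rewrite (_ : [set w | _] = \bigcap_(i in [set: I]) F i).
    by apply: fin_bigcap_measurable.
  by apply/seteqP; split => w /= h i; [move=> _|]; exact: h.
apply: measurableI.
  apply: (fcap 'I_n (fun i : 'I_n => X i @^-1` C i)) => i.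
  by rewrite -[_ @^-1` _]setTI; exact: mX.
apply: (fcap 'I_n (fun i : 'I_n => [set w | forall j : 'I_m, (j * n + i < p)%N -> B i j (Aent i j w)])) => i.
apply: (fcap 'I_m (fun j : 'I_m => [set w | (j * n + i < p)%N -> B i j (Aent i j w)])) => j.
have [ijp|ijp] := boolP (j * n + i < p)%N.
  rewrite (_ : [set w | _] = Aent i j @^-1` B i j).
    by rewrite -[_ @^-1` _]setTI; exact: mA.
  by apply/seteqP; split => w /=; [exact|].
rewrite (_ : [set w | _] = setT)//.
by apply/seteqP; split => w.
Qed.

Lemma adapted_measurable p f : adapted p f -> measurable_fun setT f.
Proof. exact: (measurable_g_sigma (past_measurable (p := p))). Qed.

Local Notation nu := (normal_prob 0 (Num.sqrt (n%:R^-1 : R))).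

(** An entry of rank at least [p] is unconstrained in a rectangle of [past p], so [B0] can be
    inserted at its place; the product rule for the enlarged rectangle then differs from the
    original one by the factor [nu B0]. *)
Lemma past_indep_entry p (i0 : 'I_n) (j0 : 'I_m) A B0 : (p <= j0 * n + i0)%N ->
  past p A -> measurable B0 ->
  P (A `&` Aent i0 j0 @^-1` B0) = (P A * nu B0)%E.
Proof.
move=> pij [C [B [mC mB ->]]] mB0.
pose B1 (i : 'I_n) (j : 'I_m) := if (j * n + i < p)%N then B i j else setT.
pose B2 i j := if (i == i0) && (j == j0) then B0 else B1 i j.
have mB1 i j : measurable (B1 i j) by rewrite /B1; case: ifP.
have mB2 i j : measurable (B2 i j) by rewrite /B2; case: ifP.
have E1 : [set w | forall (i : 'I_n) (j : 'I_m), (j * n + i < p)%N -> B i j (Aent i j w)] =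
          [set w | forall i j, B1 i j (Aent i j w)].
  apply/seteqP; split => w /= b i j; rewrite /B1.
    by case: ifP => // ijp; exact: b.
  by move=> ijp; have := b i j; rewrite /B1 ijp.
have B1T : B1 i0 j0 = setT by rewrite /B1 ltnNge pij.
have E2 : [set w | forall i j, B1 i j (Aent i j w)] `&` Aent i0 j0 @^-1` B0 =
          [set w | forall i j, B2 i j (Aent i j w)].
  apply/seteqP; split => w /=.
    by move=> [b b0] i j; rewrite /B2; case: ifP => // /andP[/eqP-> /eqP->].
  move=> b; split; last by have := b i0 j0; rewrite /B2 !eqxx.
  move=> i j; have := b i j; rewrite /B2.
  by case: ifP => // /andP[/eqP-> /eqP->]; rewrite B1T.
rewrite E1 -setIA E2 !gd.2// -muleA; congr (_ * _)%E.
rewrite [in LHS](bigD1 i0)//= [in RHS](bigD1 i0)//=.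
rewrite [in LHS](bigD1 j0)//= [in X in (_ = X * _)%E](bigD1 j0)//=.
rewrite {1}/B2 !eqxx/= B1T probability_setT mul1e [RHS]muleC [RHS]muleA.
congr (_ * _ * _)%E.
- by apply: eq_bigr => j /negbTE jj0; rewrite /B2 jj0 andbF.
- by apply: eq_bigr => i /negbTE ii0; apply: eq_bigr => j _; rewrite /B2 ii0.
Qed.

Lemma integral_entry p (i : 'I_n) (j : 'I_m) (f : T -> R -> R) : (p <= j * n + i)%N ->
  measurable_fun setT (fun x : g_sigma_algebraType (past p) * measurableTypeR R => f x.1 x.2) ->
  (forall w z, 0 <= f w z) ->
  (\int[P]_w (f w (Aent i j w))%:E = \int[P]_w \int[nu]_z (f w z)%:E)%E.
Proof.
move=> pij mf f0.
have := @integral_indep_sigma R d T P (past p) (@past_setI_closed p) (past_setT p)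
  (past_measurable (p := p)) _ (measurableTypeR R) (Aent i j) nu
  (fun x : g_sigma_algebraType (past p) * measurableTypeR R => (f x.1 x.2)%:E).
apply.
- exact: gd.1.
- by move=> A B pA mB; exact: past_indep_entry pA mB.
- exact/measurable_EFinP.
- by move=> x; rewrite lee_fin.
Qed.

(** The entries of the column are integrated out from the last to the first. Each integration yields
    a factor [K i] known before the column starts; it is absorbed into the weight, which is why the
    induction is over all [G]. *)
Lemma integral_column (j : 'I_m) (f : 'I_n -> T -> R -> R) (K : 'I_n -> T -> R) G :
  (forall i, measurable_fun setT
     (fun x : g_sigma_algebraType (past (j * n)) * measurableTypeR R => f i x.1 x.2)) ->
  (forall i w z, 0 <= f i w z) -> (forall i w, 0 <= K i w) ->
  (forall i, adapted (j * n) (K i)) ->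
  (forall i w, \int[nu]_z (f i w z)%:E = (K i w)%:E)%E ->
  adapted (j * n) G -> (forall w, 0 <= G w) ->
  (\int[P]_w (G w * \prod_i f i w (Aent i j w))%:E =
   \int[P]_w (G w * \prod_i K i w)%:E)%E.
Proof.
move=> mf f0 K0 mK fK.
have mfA q (i : 'I_n) : (i < q)%N -> adapted (j * n + q) (fun w => f i w (Aent i j w)).
  move=> iq; have mA : adapted (j * n + q) (Aent i j).
    by apply: adapted_entry; rewrite ltn_add2l.
  have := measurable_fun_pair (measurable_past_id (leq_addr q (j * n))) mA.
  exact: measurableT_comp (mf i).
suff key q : (q <= n)%N -> forall G, adapted (j * n) G -> (forall w, 0 <= G w) ->
    (\int[P]_w (G w * \prod_(i < n | (i < q)%N) f i w (Aent i j w))%:E =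
     \int[P]_w (G w * \prod_(i < n | (i < q)%N) K i w)%:E)%E.
  move=> mG G0; have := key n (leqnn n) G mG G0.
  by under eq_integral do under eq_bigl do rewrite ltn_ord;
     under [in X in _ = X]eq_integral do under eq_bigl do rewrite ltn_ord.
elim: q => [_ G' mG' G'0|q IH qn G' mG' G'0].
  by apply: eq_integral => w _; rewrite !big_pred0.
pose i0 := Ordinal qn.
have split_prod (F : 'I_n -> R) : \prod_(i < n | (i < q.+1)%N) F i =
    F i0 * \prod_(i < n | (i < q)%N) F i.
  rewrite (bigD1 i0)//=; congr (_ * _); apply: eq_bigl => i.
  by rewrite ltnS -val_eqE/= ltn_neqAle andbC.
transitivity (\int[P]_w
    (G' w * \prod_(i < n | (i < q)%N) f i w (Aent i j w) * f i0 w (Aent i0 j w))%:E)%E.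
  by apply: eq_integral => w _; rewrite split_prod mulrCA [_ * f _ _ _]mulrC mulrA.
rewrite (integral_entry (p := j * n + q) (f := fun w z =>
    G' w * \prod_(i < n | (i < q)%N) f i w (Aent i j w) * f i0 w z))//; last 2 first.
- apply: measurable_funM.
    apply: (measurableT_comp (f := fun w : g_sigma_algebraType (past (j * n + q)) =>
       G' w * \prod_(i < n | (i < q)%N) f i w (Aent i j w))) => //.
    apply: measurable_funM; first exact: adapted_widen (leq_addr _ _) mG'.
    under eq_fun do rewrite -big_filter.
    by apply: measurable_prod => i; rewrite mem_filter => /andP[iq _]; exact: mfA.
  apply: (measurableT_comp (mf i0) (g := fun x : g_sigma_algebraType (past (j * n + q)) *
    measurableTypeR R => (x.1 : g_sigma_algebraType (past (j * n)), x.2))).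
  apply: measurable_fun_pair => //.
  have mid := measurable_past_id (leq_addr q (j * n)).
  exact: (measurableT_comp mid measurable_fst).
- move=> w z; rewrite !mulr_ge0//; exact: prodr_ge0.
transitivity (\int[P]_w ((G' w * K i0 w) *
    \prod_(i < n | (i < q)%N) f i w (Aent i j w))%:E)%E.
  apply: eq_integral => w _; under eq_integral do rewrite EFinM.
  rewrite ge0_integralZl//.
  - by rewrite fK -EFinM mulrAC.
  - apply/measurable_EFinP.
    apply: (measurableT_comp (mf i0) (g := fun z => (w : g_sigma_algebraType _, z))).
    exact: measurable_fun_pair.
  - by move=> z _; rewrite lee_fin.
  - by rewrite lee_fin mulr_ge0//; apply: prodr_ge0.
rewrite IH; last 3 first.
- exact: ltnW.
- by rewrite /adapted; apply: measurable_funM; [exact: mG'|exact: mK].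
- by move=> w; rewrite mulr_ge0.
by apply: eq_integral => w _; rewrite split_prod mulrA.
Qed.

End Filtration.

(** * Conditional bounds *)

Section Controlled.
Context {R : realType} {d : measure_display} {T : measurableType d}
  (P : probability T R) (X : nat -> T -> R) (n m : nat)
  (Aent : 'I_n -> 'I_m -> T -> R).
Hypothesis mX : forall i, measurable_fun setT (X i).
Hypothesis gd : gaussian_design_indep P X Aent.
Local Notation adapted := (adapted X Aent).

(* [E(f | past p) <= kappa], tested against nonnegative [past p]-measurable
   functions of finite integral. *)
Definition controlled (p q : nat) (kappa : R) (f : T -> R) : Prop :=
  [/\ forall w, 0 <= f w, adapted q f &
    forall G, (forall w, 0 <= G w) -> adapted p G ->
      (\int[P]_w (G w)%:E < +oo)%E ->
      (\int[P]_w (G w * f w)%:E <= kappa%:E * \int[P]_w (G w)%:E)%E].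

Let madapted p f : adapted p f -> measurable_fun setT f.
Proof. exact: adapted_measurable mX gd p f. Qed.

Lemma controlled_widen p p' q q' kappa f : (p' <= p)%N -> (q <= q')%N ->
  controlled p q kappa f -> controlled p' q' kappa f.
Proof.
move=> pp qq [f0 mf Hf]; split => //; first exact: adapted_widen mf.
by move=> G G0 mG; apply: Hf => //; exact: adapted_widen mG.
Qed.

Lemma controlled_le p q kappa kappa' f : kappa <= kappa' ->
  controlled p q kappa f -> controlled p q kappa' f.
Proof.
move=> kk [f0 mf Hf]; split => // G G0 mG Goo.
apply: le_trans (Hf G G0 mG Goo) _; apply: lee_wpmul2r; last by rewrite lee_fin.
by apply: integral_ge0 => w _; rewrite lee_fin.
Qed.

Lemma controlled_markov p q kappa f c : controlled p q kappa f -> 0 < c ->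
  (P [set w | (c <= f w)%R] <= (kappa / c)%:E)%E.
Proof.
move=> [f0 mf Hf] c0.
have := Hf (fun=> 1) (fun=> ler01) (@measurable_cst _ _ _ _ _ _).
rewrite integral_cst//= probability_setT !mule1 => /(_ (ltry _)) intf.
rewrite EFinM lee_pdivlMr//.
have mfT : measurable_fun setT (EFin \o f) by apply/measurable_EFinP; exact: madapted mf.
have := le_integral_comp_abse P measurableT (@measurable_id _ _ setT)
  (fun r h => h) (fun x y _ _ h => h) mfT c0.
rewrite setTI muleC => h; apply: le_trans (le_trans h _).
  rewrite le_eqVlt; apply/orP; left; apply/eqP; congr (P _ * _)%E.
  by apply/seteqP; split => w /=; rewrite lee_fin ger0_norm.
apply: le_trans intf; rewrite le_eqVlt; apply/orP; left; apply/eqP.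
by apply: eq_integral => w _ /=; rewrite mul1r ger0_norm.
Qed.

Lemma controlled_cst p q c : 0 <= c -> controlled p q c (fun=> c).
Proof.
move=> c0; split => //; first exact: measurable_cst.
move=> G G0 mG _; under eq_integral do rewrite mulrC EFinM.
rewrite ge0_integralZl//; last by move=> w _; rewrite lee_fin.
by apply/measurable_EFinP; exact: madapted mG.
Qed.

Let fin_int (G : T -> R) : (forall w, 0 <= G w) -> (\int[P]_w (G w)%:E < +oo)%E ->
  (\int[P]_w (G w)%:E \is a fin_num)%E.
Proof.
move=> G0; rewrite -ge0_fin_numE//.
by apply: integral_ge0 => w _; rewrite lee_fin.
Qed.

Lemma controlledD p q k1 k2 f1 f2 : controlled p q k1 f1 -> controlled p q k2 f2 ->
  controlled p q (k1 + k2) (fun w => f1 w + f2 w).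
Proof.
move=> [f10 mf1 H1] [f20 mf2 H2]; split.
- by move=> w; rewrite addr_ge0.
- exact: measurable_funD.
- move=> G G0 mG Goo; under eq_integral do rewrite mulrDr EFinD.
  rewrite ge0_integralD//.
  + rewrite EFinD muleDl ?fin_int//.
    by apply: leeD; [exact: H1|exact: H2].
  + by move=> w _; rewrite lee_fin mulr_ge0.
  + by apply/measurable_EFinP; apply: measurable_funM; [exact: madapted mG|exact: madapted mf1].
  + by move=> w _; rewrite lee_fin mulr_ge0.
  + by apply/measurable_EFinP; apply: measurable_funM; [exact: madapted mG|exact: madapted mf2].
Qed.

Lemma controlledZ p q c k f : 0 <= c -> controlled p q k f ->
  controlled p q (c * k) (fun w => c * f w).
Proof.
move=> c0 [f0 mf H]; split.
- by move=> w; rewrite mulr_ge0.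
- by apply: measurable_funM => //; exact: measurable_cst.
- move=> G G0 mG Goo; under eq_integral do rewrite mulrCA EFinM.
  rewrite ge0_integralZl//.
  + by rewrite EFinM -muleA lee_wpmul2l// H.
  + by apply/measurable_EFinP; apply: measurable_funM; [exact: madapted mG|exact: madapted mf].
  + by move=> w _; rewrite lee_fin mulr_ge0.
Qed.

Lemma controlled_sum p q k (I : Type) (s : seq I) (f : I -> T -> R) :
  (forall i, controlled p q k (f i)) ->
  controlled p q ((size s)%:R * k) (fun w => \sum_(i <- s) f i w).
Proof.
move=> H; elim: s => [|i s IH].
  rewrite mul0r (_ : (fun w => _) = (fun=> 0)); first exact: controlled_cst.
  by apply/funext => w; rewrite big_nil.
rewrite (_ : (fun w => _) = (fun w => f i w + \sum_(j <- s) f j w)); last first.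
  by apply/funext => w; rewrite big_cons.
by rewrite /= mulrSr mulrDl mul1r addrC; exact: controlledD.
Qed.

(** Tower property in tested form: [G] times the earlier factors is itself an admissible test
    function for the last factor, its integral being finite by induction. *)
Lemma controlled_prod p c K kappa (f : 'I_K -> T -> R) : 0 <= kappa ->
  (forall i : 'I_K, controlled (p + i * c) (p + i.+1 * c) kappa (f i)) ->
  controlled p (p + K * c) (kappa ^+ K) (fun w => \prod_i f i w).
Proof.
move=> k0; elim: K f => [|K IH] f H.
  rewrite (_ : (fun w => _) = (fun=> 1)); first exact: controlled_cst.
  by apply/funext => w; rewrite big_ord0.
rewrite (_ : (fun w => _) = (fun w => \prod_(i < K) f (widen_ord (leqnSn K) i) w *
    f ord_max w)); last by apply/funext => w; rewrite big_ord_recr.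
have [F0 mF HF] := IH (fun i => f (widen_ord (leqnSn K) i))
  (fun i => H (widen_ord (leqnSn K) i)).
have [l0 ml Hl] := H ord_max.
split.
- by move=> w; rewrite mulr_ge0.
- by apply: measurable_funM => //; apply: adapted_widen mF; rewrite leq_add2l leq_mul2r leqnSn orbT.
- move=> G G0 mG Goo.
  pose G' w := G w * \prod_(i < K) f (widen_ord (leqnSn K) i) w.
  have G'0 w : 0 <= G' w by rewrite mulr_ge0.
  have G'le : (\int[P]_w (G' w)%:E <= (kappa ^+ K)%:E * \int[P]_w (G w)%:E)%E by exact: HF.
  under eq_integral do rewrite mulrA.
  apply: (@le_trans _ _ (kappa%:E * \int[P]_w (G' w)%:E)%E).
    apply: Hl => //.
      by apply: measurable_funM => //; apply: adapted_widen mG; exact: leq_addr.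
    apply: le_lt_trans G'le _; rewrite lte_mul_pinfty//.
    by rewrite lee_fin exprn_ge0.
  by rewrite exprS EFinM -muleA lee_wpmul2l.
Qed.

Section Column.
Variables (j : 'I_m).
Hypothesis n_gt0 : (0 < n)%N.
Let sn := Num.sqrt (n%:R^-1 : R).
Let nR_gt0 : 0 < n%:R :> R. Proof. by rewrite ltr0n. Qed.
Let sn_gt0 : 0 < sn. Proof. by rewrite sqrtr_gt0 invr_gt0. Qed.
Let sn2 : sn ^+ 2 = n%:R^-1. Proof. by rewrite sqr_sqrtr// invr_ge0 ltW. Qed.
Let col_past (i : 'I_n) : (j * n + i < j.+1 * n)%N.
Proof. by rewrite mulSn addnC ltn_add2r. Qed.

(** The entries have variance [n%:R^-1], so [n%:R] times the squared norm of a column is a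
    chi-square variable with [n] degrees of freedom, independent of the past. *)
Lemma controlled_col_sqr tau : tau < 2^-1 ->
  controlled (j * n) (j.+1 * n) ((Num.sqrt (1 - 2 * tau))^-1 ^+ n)
    (fun w => expR (tau * n%:R * \sum_i Aent i j w ^+ 2)).
Proof.
move=> tau2.
have mA i : adapted (j.+1 * n) (Aent i j) by apply: adapted_entry; exact: col_past.
split.
- by move=> w; exact: expR_ge0.
- apply: measurableT_comp => //; apply: measurable_funM; first exact: measurable_cst.
  by apply: measurable_sum => i; apply: measurable_funX; exact: mA.
- move=> G G0 mG Goo; rewrite le_eqVlt; apply/orP; left; apply/eqP.
  transitivity (\int[P]_w (G w * \prod_(i < n) (Num.sqrt (1 - 2 * tau))^-1)%:E)%E.
    rewrite -(integral_column mX gd (j := j)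
       (f := fun i w z => expR (tau * n%:R * z ^+ 2))
       (K := fun i w => (Num.sqrt (1 - 2 * tau))^-1))//.
    + by apply: eq_integral => w _; rewrite mulr_sumr expR_sum.
    + move=> i; apply: measurableT_comp => //; apply: measurable_funM => //.
      exact: measurable_funX.
    + by move=> i; exact: measurable_cst.
    + move=> i _; rewrite normal_prob_sqr_mgf//.
        by do 4 f_equal; rewrite sn2; field; rewrite gt_eqF.
      by rewrite sn2 mulrA mulfK ?gt_eqF//; lra.
  under eq_integral do rewrite prodr_const card_ord mulrC EFinM.
  rewrite ge0_integralZl//.
  + by apply/measurable_EFinP; exact: madapted mG.
  + by move=> w _; rewrite lee_fin.
Qed.

Variables (e : 'I_n -> T -> R).
Hypothesis me : forall i, adapted (j * n) (e i).
Hypothesis e1 : forall w, \sum_i e i w ^+ 2 = 1.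

Definition score (w : T) : R := \sum_i (Num.sqrt n%:R * Aent i j w) * e i w.

Lemma adapted_score : adapted (j.+1 * n) score.
Proof.
apply: measurable_sum => i; apply: measurable_funM.
  apply: measurable_funM; first exact: measurable_cst.
  by apply: adapted_entry; exact: col_past.
by apply: adapted_widen (me i); rewrite leq_mul2r leqnSn orbT.
Qed.

(** Given the past, the score is a standard normal variable, because [e] is a unit vector determined
    by the past. *)
Lemma integral_expR_score alpha G : (forall w, 0 <= G w) -> adapted (j * n) G ->
  (\int[P]_w (G w * expR (alpha * score w))%:E =
   (expR (alpha ^+ 2 / 2))%:E * \int[P]_w (G w)%:E)%E.
Proof.
move=> G0 mG.
transitivity (\int[P]_w (G w * \prod_(i < n) expR (alpha ^+ 2 / 2 * e i w ^+ 2))%:E)%E.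
  rewrite -(integral_column mX gd (j := j)
     (f := fun i w z => expR (alpha * Num.sqrt n%:R * e i w * z))
     (K := fun i w => expR (alpha ^+ 2 / 2 * e i w ^+ 2)))//.
  - apply: eq_integral => w _; rewrite -expR_sum /score mulr_sumr.
    by congr (_ * expR _)%:E; apply: eq_bigr => i _; ring.
  - move=> i; apply: measurableT_comp => //; apply: measurable_funM => //.
    apply: measurable_funM; first exact: measurable_cst.
    exact: measurableT_comp (me i) measurable_fst.
  - move=> i; apply: measurableT_comp => //; apply: measurable_funM.
      exact: measurable_cst.
    by apply: measurable_funX; exact: me.
  - move=> i w; rewrite normal_prob_mgf//; congr (_%:E); congr expR.
    rewrite sn2 !exprMn sqr_sqrtr; last exact: ltW.
    by field; rewrite gt_eqF.
under eq_integral do rewrite -expR_sum -mulr_sumr e1 mulr1 mulrC EFinM.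
rewrite ge0_integralZl//.
- by apply/measurable_EFinP; exact: madapted mG.
- by move=> w _; rewrite lee_fin.
Qed.

(** The four coefficients are evaluated by the Gaussian exponential moment. One of them is negative:
    its integral is moved to the other side, where all integrands are nonnegative, and is subtracted
    back since it is finite. *)
Lemma controlled_exp_score (a1 a2 a3 b0 b1 b2 b3 : R) (Psi := fun z =>
    expR (b0 * z) - a1 * expR (b1 * z) + a2 * expR (b2 * z) + a3 * expR (b3 * z)) :
  0 <= a1 -> 0 <= a2 -> 0 <= a3 -> (forall z, 0 <= Psi z) ->
  controlled (j * n) (j.+1 * n)
   (expR (b0 ^+ 2 / 2) - a1 * expR (b1 ^+ 2 / 2) +
    a2 * expR (b2 ^+ 2 / 2) + a3 * expR (b3 ^+ 2 / 2))
   (fun w => Psi (score w)).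
Proof.
move=> a10 a20 a30 Psi0; have ms := adapted_score.
have mE p b : adapted (j.+1 * n) (fun w => p * expR (b * score w)).
  apply: measurable_funM; first exact: measurable_cst.
  apply: measurableT_comp => //; apply: measurable_funM => //; exact: measurable_cst.
have mPsi : adapted (j.+1 * n) (fun w => Psi (score w)).
  apply: measurable_funD; last exact: mE.
  apply: measurable_funD; last exact: mE.
  apply: measurable_funB; last exact: mE.
  by under eq_fun do rewrite -[expR _]mul1r; exact: mE.
split=> // G G0 mG Goo.
have mGT := madapted mG.
have Gfin := fin_int G0 Goo.
pose g := fine (\int[P]_w (G w)%:E)%E.
have gE : (\int[P]_w (G w)%:E = g%:E)%E by rewrite fineK.
have EI a b : 0 <= a -> (\int[P]_w (G w * (a * expR (b * score w)))%:E =
    (a * expR (b ^+ 2 / 2) * g)%:E)%E.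
  move=> a0; under eq_integral do rewrite mulrCA EFinM.
  rewrite ge0_integralZl//; last 2 first.
  - apply/measurable_EFinP/measurable_funM => //.
    have := madapted (mE 1 b); by under eq_fun do rewrite mul1r.
  - by move=> w _; rewrite lee_fin mulr_ge0// expR_ge0.
  by rewrite integral_expR_score// gE -!EFinM mulrA.
have mI a b : measurable_fun setT (fun w => (G w * (a * expR (b * score w)))%:E).
  by apply/measurable_EFinP/measurable_funM => //; exact: madapted (mE a b).
have pI a b w : 0 <= a -> (0 <= (G w * (a * expR (b * score w)))%:E)%E.
  by move=> a0; rewrite lee_fin !mulr_ge0// expR_ge0.
have key : (\int[P]_w (G w * Psi (score w))%:E + (a1 * expR (b1 ^+ 2 / 2) * g)%:E =
  (1 * expR (b0 ^+ 2 / 2) * g)%:E + ((a2 * expR (b2 ^+ 2 / 2) * g)%:E +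
   (a3 * expR (b3 ^+ 2 / 2) * g)%:E))%E.
  rewrite -!EI// -!ge0_integralD//; try by move=> w _; rewrite ?adde_ge0// pI.
  - by apply: eq_integral => w _; rewrite -!EFinD; congr EFin; rewrite /Psi; ring.
  - exact: emeasurable_funD.
  - by move=> w _; rewrite lee_fin mulr_ge0.
  - by apply/measurable_EFinP/measurable_funM => //; exact: madapted mPsi.
have -> : (\int[P]_w (G w * Psi (score w))%:E)%E =
  ((1 * expR (b0 ^+ 2 / 2) * g)%:E + ((a2 * expR (b2 ^+ 2 / 2) * g)%:E +
   (a3 * expR (b3 ^+ 2 / 2) * g)%:E) - (a1 * expR (b1 ^+ 2 / 2) * g)%:E)%E.
  by rewrite -key addeK.
by rewrite gE -EFinM -!EFinD lee_fin; lra.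
Qed.

End Column.

End Controlled.

(** * The deterministic recursion *)

Section Drift.
Context {R : realType}.
(** Dividing the recursion by [1 - rho] gives [D' ^+ 2 <= D ^+ 2 + a * (D - 1) ^+ 2 + a * g + 2 * (a
    * x * D)]. Here [E] bounds the excess of [D] over 1, and the claim follows by squaring the
    proposed bound: its cross term contains [a * (E + E ^+ 2)], which pays for the quadratic
    drift. *)
Lemma drift_step (rho a D D' x g E : R) : 0 < rho -> rho <= 2^-1 ->
  a * (1 - rho) = rho -> 0 <= x -> 0 <= g -> 0 <= D -> 0 <= E -> D <= 1 + E ->
  (1 - rho) * D' ^+ 2 <= D ^+ 2 - 2 * rho * D * (1 - x) + rho * (1 + g) ->
  D' <= 1 + ((1 + a / 2) * E + a * (x + g / 2)).
Proof.
move=> rho0 rho1 arho x0 g0 D0 E0 DE Hrec.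
have a0 : 0 <= a.
  by rewrite -(@pmulr_lge0 _ (1 - rho)) ?arho; lra.
have a1 : a <= 1 by nra.
have DE2 : D ^+ 2 + a * (D - 1) ^+ 2 <= (1 + E) ^+ 2 + a * E ^+ 2.
  have [D1|D1] := lerP D 1; last first.
    apply: lerD; first by rewrite lerXn2r ?nnegrE//; lra.
    by apply: ler_wpM2l => //; rewrite lerXn2r ?nnegrE//; lra.
  (* When [D <= 1], the inequality [a <= 1] bounds the left side by [D + (1 - D)]. *)
  apply: (@le_trans _ _ 1); last by nra.
  have h1 : D ^+ 2 <= D by nra.
  have h2 : a * (D - 1) ^+ 2 <= (1 - D) by nra.
  by lra.
have xDE : a * x * D <= a * x * (1 + E) by apply: ler_wpM2l => //; exact: mulr_ge0.
have D'2 : D' ^+ 2 <= (1 + E) ^+ 2 + a * (E ^+ 2 + g + 2 * x * (1 + E)).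
  rewrite -(@ler_pM2l _ (1 - rho)); last by lra.
  apply: le_trans Hrec _.
  have -> : D ^+ 2 - 2 * rho * D * (1 - x) + rho * (1 + g) =
     (1 - rho) * (D ^+ 2 + a * (D - 1) ^+ 2 + a * g + 2 * (a * x * D)).
    have -> : D ^+ 2 - 2 * rho * D * (1 - x) + rho * (1 + g) = (1 - rho) * D ^+ 2 +
        rho * ((D - 1) ^+ 2 + g + 2 * (x * D)) by ring.
    by rewrite -{2}arho; ring.
  by apply: ler_wpM2l; lra.
set z := a / 2 * E + a * (x + g / 2).
have z0 : 0 <= z by rewrite /z; apply: addr_ge0; apply: mulr_ge0 => //; lra.
have -> : 1 + ((1 + a / 2) * E + a * (x + g / 2)) = 1 + E + z by rewrite /z; ring.
rewrite leNgt; apply/negP => zD.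
have : (1 + E + z) ^+ 2 < D' ^+ 2 by rewrite ltr_pXn2r ?nnegrE//; lra.
apply/negP; rewrite -leNgt; apply: le_trans D'2 _.
have -> : (1 + E + z) ^+ 2 = (1 + E) ^+ 2 + 2 * (1 + E) * z + z ^+ 2 by ring.
have z20 : 0 <= z ^+ 2 by exact: sqr_ge0.
have -> : 2 * (1 + E) * z = a * (E + E ^+ 2 + 2 * x * (1 + E) + g + g * E).
  by rewrite /z; field.
have : a * (E ^+ 2 + g + 2 * x * (1 + E)) <= a * (E + E ^+ 2 + 2 * x * (1 + E) + g + g * E).
  by apply: ler_wpM2l => //; have := mulr_ge0 g0 E0; lra.
by lra.
Qed.

(** Iteration of [drift_step] for the normalised values [V l / (q * k ^+ l)], with [k] the square
    root of [1 - rho]. Each noise term is charged the full growth factor [(1 + a / 2) ^+ L],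
    whatever the step at which it enters. *)
Lemma drift_recursion (rho a q E0 : R) (L : nat) (V x g : nat -> R) :
  0 < rho -> rho <= 2^-1 -> a * (1 - rho) = rho -> 0 < q -> 0 <= E0 ->
  (forall l, 0 <= V l) -> (forall l, 0 <= x l) -> (forall l, 0 <= g l) ->
  V 0%N <= q * (1 + E0) ->
  (forall l, (l < L)%N -> V l.+1 ^+ 2 <= V l ^+ 2
     - 2 * rho * (q * Num.sqrt (1 - rho) ^+ l) * V l * (1 - x l)
     + rho * (q * Num.sqrt (1 - rho) ^+ l) ^+ 2 * (1 + g l)) ->
  V L <= q * Num.sqrt (1 - rho) ^+ L *
    (1 + (1 + a / 2) ^+ L * (E0 + a * \sum_(l < L) (x l + g l / 2))).
Proof.
move=> rho0 rho1 arho q0 E00 V0 x0 g0 hV0 Hrec.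
have a0 : 0 <= a.
  by rewrite -(@pmulr_lge0 _ (1 - rho)) ?arho; lra.
set k := Num.sqrt (1 - rho); have k2 : k ^+ 2 = 1 - rho by rewrite sqr_sqrtr//; lra.
have k0 : 0 < k by rewrite sqrtr_gt0; lra.
elim: L Hrec => [|L IH] Hrec.
  by rewrite big_ord0 !expr0 mulr0 addr0 mul1r mulr1.
have {}IH := IH (fun l lL => Hrec l (ltnW lL)).
set S := \sum_(l < L) _ in IH.
have S0 : 0 <= S by apply: sumr_ge0 => i _; have := x0 i; have := g0 i; lra.
set E := (1 + a / 2) ^+ L * (E0 + a * S) in IH.
have E_ge0 : 0 <= E.
  by apply: mulr_ge0; [apply: exprn_ge0; lra|apply: addr_ge0 => //; exact: mulr_ge0].
set qL := q * k ^+ L; have qL0 : 0 < qL by rewrite mulr_gt0// exprn_gt0.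
have Hstep := Hrec L (ltnSn L); rewrite -/k -/qL in Hstep.
have h : V L.+1 / (qL * k) <= 1 + ((1 + a / 2) * E + a * (x L + g L / 2)).
  apply: (@drift_step rho a (V L / qL)) => //.
  - by apply: divr_ge0 => //; exact: ltW.
  - by rewrite ler_pdivrMr// mulrC.
  - rewrite -k2 -(@ler_pM2l _ (qL ^+ 2)); last exact: exprn_gt0.
    have -> : qL ^+ 2 * (k ^+ 2 * (V L.+1 / (qL * k)) ^+ 2) = V L.+1 ^+ 2.
      by field; rewrite !gt_eqF.
    apply: le_trans Hstep _; rewrite le_eqVlt; apply/orP; left; apply/eqP.
    by field; rewrite gt_eqF.
rewrite ler_pdivrMr in h; last exact: mulr_gt0.
apply: le_trans h _; rewrite mulrC.
have -> : q * k ^+ L.+1 = qL * k by rewrite /qL exprSr mulrA.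
apply: ler_wpM2l; first by apply: mulr_ge0; exact: ltW.
rewrite lerD2l big_ord_recr/= -/S exprS mulrDr mulrDr.
have -> : (1 + a / 2) * (1 + a / 2) ^+ L * E0 + (1 + a / 2) * (1 + a / 2) ^+ L * (a * (S + (x L + g L / 2)))
  = (1 + a / 2) * E + (1 + a / 2) ^+ L.+1 * (a * (x L + g L / 2)).
  by rewrite /E exprS; ring.
rewrite lerD2l -mulrDr ler_peMl//.
  by apply: mulr_ge0 => //; have := x0 L; have := g0 L; lra.
by apply: exprn_ege1; lra.
Qed.

Lemma expR_le1D2x (y : R) : 0 <= y -> y <= 2^-1 -> expR y <= 1 + 2 * y.
Proof.
move=> y0 y1.
have : 1 - y <= expR (- y) by exact: expR_ge1Dx.
rewrite expRN => h.
have e0 := expR_gt0 y.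
have : (1 - y) * expR y <= 1 by rewrite -ler_pdivlMr// div1r.
nra.
Qed.

(** Since [a * L] is at most [2 * Rt * (1 + 2 * rho)], the growth factor is at most [expR (Rt + y)]
    with [y = 2 * Rt * rho]. The lower bounds on [L] give [rho <= 8^-1], [y <= 4^-1] and
    [2 * y * d0 <= Rt * (d1 + d2)]. The noise then costs at most 3/2 times 5/2, and the correction
    to [d0] at most 1, in units of [Rt * (d1 + d2)]; 15/4 + 1 is below 5. *)
Lemma rate_constants (Rt d0 d1 d2 L : R) (rho := 2 * Rt / L) (a := rho / (1 - rho)) (l : nat) :
  0 < Rt -> 0 < d0 -> 0 < d1 -> 0 < d2 -> L = l%:R ->
  0 < L -> 16 * Rt <= L -> 16 * Rt ^+ 2 <= L -> 8 * Rt * d0 <= L * (d1 + d2) ->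
  [/\ 0 < rho, rho <= 2^-1, a * (1 - rho) = rho,
    (1 + a / 2) ^+ l * (d0 + a * (L * (d2 + d1 / 2))) <=
      expR Rt * (d0 + 5 * Rt * (d1 + d2)) &
    (1 - rho) ^+ l <= expR (- (2 * Rt))].
Proof.
move=> Rt0 d00 d10 d20 Ll L0 L16 L16b Ld0.
have rhoL : rho * L = 2 * Rt by rewrite /rho; field; rewrite gt_eqF.
have rho0 : 0 < rho by rewrite /rho; apply: divr_gt0 => //; lra.
have rho1 : rho <= 8^-1 by rewrite /rho ler_pdivrMr//; lra.
have rho_n1 : 1 - rho != 0 by apply/eqP; lra.
have arho : a * (1 - rho) = rho by rewrite /a divfK.
have a0 : 0 < a by rewrite /a; apply: divr_gt0; lra.
have a_le : a <= rho * (1 + 2 * rho) by rewrite /a ler_pdivrMr; nra.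
clearbody a rho.
split => //; first by lra.
- have aL : a * L <= 2 * Rt * (1 + 2 * rho).
    by have := ler_wpM2r (ltW L0) a_le; rewrite [X in _ <= X]mulrAC rhoL.
  have pow_le : (1 + a / 2) ^+ l <= expR (Rt + 2 * Rt * rho).
    apply: (@le_trans _ _ (expR (a / 2) ^+ l)).
      rewrite lerXn2r ?nnegrE ?expR_ge0//; [lra|exact: expR_ge1Dx].
    rewrite -expRM_natr ler_expR -Ll; lra.
  have e_le : expR (2 * Rt * rho) <= 1 + 2 * (2 * Rt * rho).
    apply: expR_le1D2x; first by apply: mulr_ge0; lra.
    rewrite -(ler_pM2r L0) -[2 * Rt * rho * L]mulrA rhoL; nra.
  set y := 2 * Rt * rho in e_le pow_le *.
  have y0 : 0 <= y by apply: mulr_ge0; lra.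
  have yL : y * L = 4 * Rt ^+ 2 by rewrite /y -mulrA rhoL; ring.
  have y1 : y <= 4^-1 by rewrite -(ler_pM2r L0) yL; lra.
  have yd0 : 2 * y * d0 <= Rt * (d1 + d2) by rewrite -(ler_pM2r L0); nra.
  apply: (@le_trans _ _ (expR (Rt + y) * (d0 + 2 * Rt * (1 + 2 * rho) * (d2 + d1 / 2)))).
    apply: ler_pM => //.
    + by apply: exprn_ge0; lra.
    + by apply: addr_ge0; [lra|apply: mulr_ge0; [lra|apply: mulr_ge0; lra]].
    + rewrite lerD2l mulrA; apply: ler_wpM2r => //; lra.
  rewrite expRD -mulrA; apply: ler_wpM2l; first exact: expR_ge0.
  set S := d2 + d1 / 2; have S0 : 0 <= S by rewrite /S; lra.
  have SS : S <= d1 + d2 by rewrite /S; lra.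
  apply: (@le_trans _ _ ((1 + 2 * y) * (d0 + 2 * Rt * (1 + 2 * rho) * S))).
    apply: ler_wpM2r => //; apply: addr_ge0; first lra.
    by apply: mulr_ge0 => //; apply: mulr_ge0; lra.
  have RS : 0 <= Rt * S by apply: mulr_ge0 => //; lra.
  have h1 : 2 * Rt * (1 + 2 * rho) * S <= 5 / 2 * (Rt * S).
    have -> : 2 * Rt * (1 + 2 * rho) * S = (2 + 4 * rho) * (Rt * S) by ring.
    by apply: ler_wpM2r => //; lra.
  have h2 : (1 + 2 * y) * (2 * Rt * (1 + 2 * rho) * S) <= 3 / 2 * (5 / 2 * (Rt * S)).
    apply: ler_pM => //; [lra| |lra].
    by apply: mulr_ge0 => //; apply: mulr_ge0; lra.
  have h3 : Rt * S <= Rt * (d1 + d2) by apply: ler_wpM2l => //; exact: ltW.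
  rewrite mulrDr; lra.
- apply: (@le_trans _ _ (expR (- rho) ^+ l)).
    rewrite lerXn2r ?nnegrE ?expR_ge0//; [lra|].
    by have := expR_ge1Dx (- rho); lra.
  by rewrite -expRM_natr ler_expR -Ll; lra.
Qed.

End Drift.

(** * The encoder *)

Section EncoderResidual.
Context {R : realType} (n M L : nat) (sigma Rt : R).
Implicit Types (A : 'M[R]_(n, M * L)) (r s : 'cV[R]_n) (l : 'I_L).

Definition sc_residual A s (ls : seq 'I_L) : 'cV[R]_n :=
  (foldl (sc_step sigma Rt A) (s, 0) ls).1.

(** Every encoder step preserves the sum of the residual and [A] applied to the current coefficient
    vector. *)
Lemma residual_sc_beta A s : s - A *m sc_beta sigma Rt A s = sc_residual A s (enum 'I_L).
Proof.
suff key ls st : (foldl (sc_step sigma Rt A) st ls).1 +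
    A *m (foldl (sc_step sigma Rt A) st ls).2 = st.1 + A *m st.2.
  have := key (enum 'I_L) (s, 0); rewrite /= mulmx0 addr0 => sE.
  by rewrite -[X in X - _]sE addrK.
elim: ls st => //= l ls IH st; rewrite IH /sc_step; case: pickP => //= k _.
by rewrite mulmxDr -scalemxAr -colE addrCA subrK addrC.
Qed.

Lemma sc_residual_rcons A s ls l : exists b,
  sc_residual A s (rcons ls l) = (sc_step sigma Rt A (sc_residual A s ls, b) l).1.
Proof.
rewrite /sc_residual -cats1 foldl_cat/=; set st := foldl _ _ _.
by exists st.2; rewrite -surjective_pairing.
Qed.

Lemma sc_step_max A r b l : (0 < M)%N -> exists k : 'I_M,
  (forall k', sc_score A r l k' <= sc_score A r l k) /\
  (sc_step sigma Rt A (r, b) l).1 = r - sc_coef M L sigma Rt l *: col (ordML l k) A.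
Proof.
move=> M0; rewrite /sc_step; case: pickP => /= [k /forallP kmax|nomax].
  by exists k.
have [k _ kmax] := @arg_maxP _ _ _ (Ordinal M0) predT (sc_score A r l) isT.
have := nomax k => /negbT/negP[].
by apply/forallP => k'; exact: kmax.
Qed.

Lemma enorm_sqr r : enorm r ^+ 2 = \sum_i r i 0 ^+ 2.
Proof. by rewrite sqr_sqrtr// sumr_ge0// => i _; exact: sqr_ge0. Qed.

Lemma enorm_ge0 r : 0 <= enorm r.
Proof. exact: sqrtr_ge0. Qed.

(* [r / enorm r], or the first basis vector if [r = 0]: the scores are taken
   along a unit vector in all cases. *)
Definition sc_dir r (i : 'I_n) : R :=
  if enorm r == 0 then (val i == 0%N)%:R else r i 0 / enorm r.

Lemma sum_sc_dir_sqr r : (0 < n)%N -> \sum_i sc_dir r i ^+ 2 = 1.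
Proof.
move=> n0; rewrite /sc_dir; have [r0|r0] := eqVneq (enorm r) 0.
  rewrite (bigD1 (Ordinal n0))//= expr1n big1 ?addr0// => i.
  by rewrite -val_eqE/= => /negbTE ->; rewrite expr0n.
under eq_bigr do rewrite expr_div_n.
by rewrite -mulr_suml -enorm_sqr divff// expf_neq0.
Qed.

Lemma enorm_sc_dir r i : enorm r * sc_dir r i = r i 0.
Proof.
rewrite /sc_dir; have [r0|r0] := eqVneq (enorm r) 0; last by rewrite mulrC divfK.
rewrite r0 mul0r; apply/eqP; rewrite eq_sym -sqrf_eq0.
have := enorm_sqr r; rewrite r0 expr0n/= => /esym/eqP.
rewrite psumr_eq0 => [/allP/(_ i)|i' _]; last exact: sqr_ge0.
by rewrite mem_index_enum => /(_ isT).
Qed.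

Lemma enorm_sub_scale_sqr r (a : 'cV[R]_n) c :
  enorm (r - c *: a) ^+ 2 =
    enorm r ^+ 2 - 2 * c * enorm r * \sum_i a i 0 * sc_dir r i + c ^+ 2 * \sum_i a i 0 ^+ 2.
Proof.
rewrite !enorm_sqr !mulr_sumr -sumrB -big_split/=; apply: eq_bigr => i _.
rewrite !mxE -(enorm_sc_dir r i); ring.
Qed.

Lemma sc_scoreE A r l k : enorm r != 0 ->
  sc_score A r l k = \sum_i (Num.sqrt n%:R * A i (ordML l k)) * sc_dir r i.
Proof. by move=> r0; rewrite /sc_dir (negbTE r0). Qed.

End EncoderResidual.

(** * Measurability of the encoder *)

Section Measurability.
Context {R : realType} {d : measure_display} {T : measurableType d}.

(** Expansion as a finite sum over all truth tables, each weighted by its indicator. It serves to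
    handle the argmax, which is decided by finitely many comparisons. *)
Lemma measurable_fun_finite_table (I : finType) (b : I -> T -> bool)
    (F : {ffun I -> bool} -> T -> R) :
  (forall i, measurable_fun setT (b i)) -> (forall S, measurable_fun setT (F S)) ->
  measurable_fun setT (fun w => F [ffun i => b i w] w).
Proof.
move=> mb mF.
rewrite (_ : (fun w => _) = (fun w => \sum_(S : {ffun I -> bool})
    (\prod_i (if b i w == S i then 1 else 0)) * F S w)); last first.
  apply/funext => w; rewrite (bigD1 [ffun i => b i w])//= big1 ?mul1r; last first.
    by move=> i _; rewrite ffunE eqxx.
  rewrite big1 ?addr0// => S SE.
  have [i bS] : exists i, b i w != S i.
    apply/existsP; rewrite -negb_forall; apply: contra SE => /forallP h.
    by apply/eqP/ffunP => i; rewrite ffunE; apply/esym/eqP/h.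
  by rewrite (bigD1 i)//= (negbTE bS) !mul0r.
apply: measurable_sum => S; apply: measurable_funM => //.
apply: measurable_prod => i _; apply: measurable_fun_ifT => //.
case: (S i).
  by under eq_fun do rewrite eqb_id; exact: mb.
by under eq_fun do rewrite eqbF_neg; exact: measurable_neg.
Qed.

Lemma measurable_sqrtr : measurable_fun setT (Num.sqrt : R -> R).
Proof.
by apply: nondecreasing_measurable => // x y yx; exact: ler_wsqrtr yx.
Qed.

Context {n : nat}.

Lemma measurable_enorm (r : T -> 'cV[R]_n) :
  (forall i, measurable_fun setT (fun w => r w i 0)) ->
  measurable_fun setT (fun w => enorm (r w)).
Proof.
move=> mr; apply: (measurableT_comp measurable_sqrtr).
by apply: measurable_sum => i; exact: measurable_funX.
Qed.

Lemma measurable_div_enorm (r : T -> 'cV[R]_n) i :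
  (forall i, measurable_fun setT (fun w => r w i 0)) ->
  measurable_fun setT (fun w => r w i 0 / enorm (r w)).
Proof.
move=> mr; apply: measurable_funM => //.
(* On nonnegative reals, 0 included, the inverse is the power [-1], and powers are measurable. *)
rewrite (_ : (fun w => _) = (fun w => enorm (r w) `^ (-1))); last first.
  by apply/funext => w; rewrite powR_inv1// enorm_ge0.
apply: (measurableT_comp (f := fun x : R => x `^ (-1))); last exact: measurable_enorm.
exact: measurable_powR.
Qed.

Lemma measurable_sc_dir (r : T -> 'cV[R]_n) i :
  (forall i, measurable_fun setT (fun w => r w i 0)) ->
  measurable_fun setT (fun w => sc_dir (r w) i).
Proof.
move=> mr; apply: measurable_fun_ifT.
- by apply: measurable_fun_eqr => //; exact: measurable_enorm.
- exact: measurable_cst.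
- exact: measurable_div_enorm.
Qed.

Context {M L : nat} (sigma Rt : R) (A : T -> 'M[R]_(n, M * L)).

Lemma measurable_sc_step (r : T -> 'cV[R]_n) (b : T -> 'cV[R]_(M * L)) (l : 'I_L) :
  (forall i, measurable_fun setT (fun w => r w i 0)) ->
  (forall i k, measurable_fun setT (fun w => A w i (ordML l k))) ->
  forall i, measurable_fun setT (fun w => (sc_step sigma Rt (A w) (r w, b w) l).1 i 0).
Proof.
move=> mr mA i.
pose cmp (kk : 'I_M * 'I_M) w := sc_score (A w) (r w) l kk.1 <= sc_score (A w) (r w) l kk.2.
have mscore k : measurable_fun setT (fun w => sc_score (A w) (r w) l k).
  apply: measurable_sum => i'; apply: measurable_funM; last exact: measurable_div_enorm.
  by apply: measurable_funM => //; exact: measurable_cst.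
(* [S] stands for the table of all pairwise score comparisons; once it is fixed, so is the selected
   column. *)
pose F (S : {ffun 'I_M * 'I_M -> bool}) w :=
  if [pick k : 'I_M | [forall k', S (k', k)]] is Some k
  then r w i 0 - sc_coef M L sigma Rt l * A w i (ordML l k) else r w i 0.
rewrite (_ : (fun w => _) = (fun w => F [ffun kk => cmp kk w] w)).
  apply: measurable_fun_finite_table => [kk|S]; first exact: measurable_fun_ler.
  rewrite /F; case: pickP => [k _|_] //.
  by apply: measurable_funB => //; apply: measurable_funM => //; exact: measurable_cst.
apply/funext => w; rewrite /sc_step /F/=.
have -> : [pick k : 'I_M | [forall k', [ffun kk => cmp kk w] (k', k)]] =
  [pick k : 'I_M | [forall k', sc_score (A w) (r w) l k' <= sc_score (A w) (r w) l k]].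
  by apply: eq_pick => k; apply: eq_forallb => k'; rewrite ffunE.
by case: pickP => //= k _; rewrite !mxE.
Qed.

Lemma measurable_sc_residual (s : T -> 'cV[R]_n) (ls : seq 'I_L) :
  (forall i, measurable_fun setT (fun w => s w i 0)) ->
  (forall l, l \in ls -> forall i k, measurable_fun setT (fun w => A w i (ordML l k))) ->
  forall i, measurable_fun setT (fun w => sc_residual sigma Rt (A w) (s w) ls i 0).
Proof.
move=> ms; elim/last_ind: ls => [_ //|ls l IH] mA i.
(* The chosen [b] carries no measurability; this is harmless, since the new residual depends only on
   the old residual and the matrix. *)
have [b bE] := choice (fun w => sc_residual_rcons sigma Rt (A w) (s w) ls l).
under eq_fun do rewrite bE.
apply: measurable_sc_step => [i'|i' k].
  by apply: IH => l' l'ls; apply: mA; rewrite mem_rcons inE l'ls orbT.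
by apply: mA; rewrite mem_rcons mem_head.
Qed.

End Measurability.

(** * The tilted exponential combination *)

Section TiltedBound.
Context {R : realType}.
Implicit Types lam theta z : R.

(* [expR (- theta * z)] times an upper bound of the indicator of [z < lam - 2]
   (factored in [tiltedE]): the tilt [expR (lam * z)] is cut off on both sides by
   exponentials of rates [lam + 2] and [lam - 2], so that the Gaussian mean stays
   explicit and falls below 1 by about [expR (- lam ^+ 2 / 2)]. *)
Definition tilted lam theta z : R :=
  expR (- theta * z)
  - expR (- (lam * (lam + 2))) * expR ((lam - theta) * z)
  + expR (- ((lam + 2) * (lam + 2))) * expR ((lam + 2 - theta) * z)
  + expR (- (lam * (lam + 2)) + 2 * (lam - 2)) * expR ((lam - 2 - theta) * z).

Lemma tiltedE lam theta z : tilted lam theta z =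
  expR (- theta * z) * (1 - expR (lam * (z - (lam + 2))) *
    (1 - expR (2 * (z - (lam + 2))) - expR (- (2 * (z - (lam - 2)))))).
Proof.
have e1 : expR (- (lam * (lam + 2))) * expR ((lam - theta) * z) =
  expR (- theta * z) * expR (lam * (z - (lam + 2))).
  by rewrite -!expRD; congr expR; ring.
have e2 : expR (- ((lam + 2) * (lam + 2))) * expR ((lam + 2 - theta) * z) =
  expR (- theta * z) * expR (lam * (z - (lam + 2))) * expR (2 * (z - (lam + 2))).
  by rewrite -!expRD; congr expR; ring.
have e3 : expR (- (lam * (lam + 2)) + 2 * (lam - 2)) * expR ((lam - 2 - theta) * z) =
  expR (- theta * z) * expR (lam * (z - (lam + 2))) * expR (- (2 * (z - (lam - 2)))).
  by rewrite -!expRD; congr expR; ring.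
by rewrite /tilted e1 e2 e3; ring.
Qed.

(** Up to [lam + 2] the tilt factor is at most 1, so the subtracted product is at most 1; beyond,
    the upper cut-off exceeds 1 and makes the bracket nonpositive. *)
Lemma tilted_ge0 lam theta z : 0 <= lam -> 0 <= tilted lam theta z.
Proof.
move=> lam0; rewrite tiltedE mulr_ge0 ?expR_ge0// subr_ge0.
set e1 := expR (lam * _); set e2 := expR (2 * _); set e3 := expR _.
have e10 : 0 <= e1 by exact: expR_ge0.
have e20 : 0 <= e2 by exact: expR_ge0.
have e30 : 0 <= e3 by exact: expR_ge0.
have [zb|zb] := lerP z (lam + 2).
  have e11 : e1 <= 1.
    by rewrite /e1 -[X in _ <= X]expR0 ler_expR mulr_ge0_le0//; lra.
  by nra.
have e21 : 1 <= e2 by rewrite /e2 -[X in X <= _]expR0 ler_expR; lra.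
by nra.
Qed.

(** Below [lam - 2] the lower cut-off exceeds 1, so the subtracted product is nonpositive. *)
Lemma tilted_ge lam theta z : z <= lam - 2 -> expR (- theta * z) <= tilted lam theta z.
Proof.
move=> zv; rewrite tiltedE ler_peMr ?expR_ge0// lerBrDl gerDr.
apply: mulr_ge0_le0; first exact: expR_ge0.
have : 1 <= expR (- (2 * (z - (lam - 2)))) by rewrite -[X in X <= _]expR0 ler_expR; lra.
by have := expR_ge0 (2 * (z - (lam + 2))); lra.
Qed.

Lemma expRN_le (y c : R) : 0 < c -> c^-1 <= expR y -> expR (- y) <= c.
Proof. by move=> c0 h; rewrite expRN -[c]invrK lef_pV2 ?posrE ?invr_gt0 ?expR_gt0. Qed.

(** From [expR 2^-1 >= 3 / 2], the two terms are at most 16/81 and 8/27, with sum 40/81. *)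
Lemma expRN2_bounds (theta : R) : 0 <= theta -> theta <= 4^-1 ->
  expR (- 2 - 2 * theta) + expR (- 2 + 2 * theta) <= 2^-1.
Proof.
move=> t0 t1.
have h : (3 / 2 : R) <= expR 2^-1 by have := expR_ge1Dx (2^-1 : R); lra.
have h2 : 9 / 4 <= expR (2^-1 : R) ^+ 2 by rewrite expr2; nra.
have h3 : expR (- 2 + 2 * theta) <= 8 / 27.
  apply: (@le_trans _ _ (expR (- (3%:R * 2^-1)))); first by rewrite ler_expR; lra.
  apply: expRN_le; first lra.
  by rewrite expRM_natl exprS invf_div; nra.
have h4 : expR (- 2 - 2 * theta) <= 16 / 81.
  apply: (@le_trans _ _ (expR (- (4%:R * 2^-1)))); first by rewrite ler_expR; lra.
  apply: expRN_le; first lra.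
  by rewrite expRM_natl invf_div (exprD _ 2 2); nra.
lra.
Qed.

(** The left side is the mean of [tilted] under a standard normal law, in the form given by
    [controlled_exp_score]. Relative to the subtracted term [b * c], the two cut-offs cost at most
    one half, leaving [b * (1 - c / 2)]; moreover [q <= c] because [lam * theta <= 1]. *)
Lemma tilted_mgf_le lam theta : 0 <= theta -> theta <= 4^-1 -> lam * theta <= 1 ->
  expR ((- theta) ^+ 2 / 2)
  - expR (- (lam * (lam + 2))) * expR ((lam - theta) ^+ 2 / 2)
  + expR (- ((lam + 2) * (lam + 2))) * expR ((lam + 2 - theta) ^+ 2 / 2)
  + expR (- (lam * (lam + 2)) + 2 * (lam - 2)) * expR ((lam - 2 - theta) ^+ 2 / 2)
  <= expR (theta ^+ 2 / 2 - 2^-1 * expR (- (lam ^+ 2 / 2) - 2 * lam - 1)).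
Proof.
move=> t0 t1 lt1.
set q := expR (- (lam ^+ 2 / 2) - 2 * lam - 1).
have q0 : 0 <= q by exact: expR_ge0.
set c := expR (- (lam ^+ 2 / 2) - 2 * lam - lam * theta).
have qc : q <= c by rewrite ler_expR; lra.
set b := expR (theta ^+ 2 / 2).
have -> : expR (- (lam * (lam + 2))) * expR ((lam - theta) ^+ 2 / 2) = b * c.
  by rewrite -!expRD; congr expR; field.
have -> : expR (- ((lam + 2) * (lam + 2))) * expR ((lam + 2 - theta) ^+ 2 / 2) =
    b * c * expR (- 2 - 2 * theta).
  by rewrite -!expRD; congr expR; field.
have -> : expR (- (lam * (lam + 2)) + 2 * (lam - 2)) * expR ((lam - 2 - theta) ^+ 2 / 2) =
    b * c * expR (- 2 + 2 * theta).
  by rewrite -!expRD; congr expR; field.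
have -> : expR ((- theta) ^+ 2 / 2) = b by rewrite sqrrN.
have -> : b - b * c + b * c * expR (- 2 - 2 * theta) + b * c * expR (- 2 + 2 * theta) =
  b * (1 - c * (1 - (expR (- 2 - 2 * theta) + expR (- 2 + 2 * theta)))) by ring.
rewrite [X in _ <= X]expRD -/b; apply: ler_wpM2l; first exact: expR_ge0.
apply: le_trans (expR_ge1Dx _).
by have := expRN2_bounds t0 t1; nra.
Qed.

Lemma expR_ge_sqr (s : R) : 0 <= s -> s ^+ 2 / 2 <= expR s.
Proof. by move=> s0; have := expR_ge1Dxn 1 s0; rewrite (_ : 2`!%N = 2%N) ?lerD2l; [lra|]. Qed.

(** The last inequality says that the [M] factors of a section outweigh [expR (4 * ell)]. The
    threshold [lam - 2 = u * (1 - x0)] makes [lam ^+ 2 / 2] fall short of [ell] by enough that [M]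
    times the tail term is at least [16 * ell], while the term in [theta ^+ 2] costs at most
    [ell]. *)
Lemma tilted_constants (ell x0 u M : R) (theta := 4 * ell / (M * u))
    (lam := u * (1 - x0) + 2) :
  0 < x0 -> x0 <= 2^-1 -> 512 <= ell * x0 ^+ 2 -> M = expR ell ->
  0 < u -> u ^+ 2 = 2 * ell ->
  [/\ 0 <= theta, theta <= 4^-1, 0 <= lam, lam * theta <= 1 &
   4 * ell + M * (theta ^+ 2 / 2 - 2^-1 * expR (- (lam ^+ 2 / 2) - 2 * lam - 1)) <= 0].
Proof.
move=> x00 x01 hell ME u0 u2.
have x02 : x0 ^+ 2 <= 4^-1 by nra.
have ell0 : 2048 <= ell by nra.
have M_ge : 1024 * ell <= M.
  by rewrite ME; apply: le_trans (expR_ge_sqr _); [nra|lra].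
have M0 : 0 < M by rewrite ME expR_gt0.
have uth : u * theta = 4 * ell / M by rewrite /theta; field; rewrite !gt_eqF.
have uth_le : u * theta <= 256^-1 by rewrite uth ler_pdivrMr//; lra.
have th0 : 0 <= theta by rewrite /theta divr_ge0//; [lra|rewrite mulr_ge0// ltW].
have u64 : 64 <= u.
  rewrite leNgt; apply/negP => u64.
  have : u ^+ 2 < 64 ^+ 2 by rewrite ltr_pXn2r ?nnegrE//; lra.
  rewrite u2; lra.
have th1 : theta <= 4^-1.
  have : 64 * theta <= u * theta by apply: ler_wpM2r.
  lra.
have lam0 : 0 <= lam by rewrite /lam addr_ge0// mulr_ge0//; lra.
split => //.
  rewrite /lam mulrDl -mulrA [(1 - x0) * theta]mulrC mulrA.
  have : u * theta * (1 - x0) <= u * theta by apply: ler_piMr; [rewrite mulr_ge0// ltW|lra].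
  lra.
have Mth : M * (theta ^+ 2 / 2) <= ell.
  have -> : M * (theta ^+ 2 / 2) = 8 * ell ^+ 2 / (M * u ^+ 2).
    by rewrite /theta; field; rewrite !gt_eqF.
  rewrite u2 ler_pdivrMr; last by apply: mulr_gt0 => //; lra.
  by nra.
set s := ell * x0 / 2.
have xell : 512 <= ell * x0 by nra.
(* The gain from [(1 - x0) ^+ 2] is about [2 * (ell * x0)]; the linear terms in [u] are absorbed
   because [u * x0 >= 32], and a net gain of [s] remains. *)
have s_le : s - ell <= - (lam ^+ 2 / 2) - 2 * lam - 1.
  have u_x0 : 32 <= u * x0.
    rewrite leNgt; apply/negP => ux.
    have ux0 : 0 <= u * x0 by apply: mulr_ge0; lra.
    have : (u * x0) ^+ 2 < 32 ^+ 2 by rewrite ltr_pXn2r ?nnegrE//; lra.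
    rewrite exprMn u2; lra.
  have u_le : 4 * u <= ell * x0 / 4.
    have : 32 * u <= u * x0 * u by apply: ler_wpM2r => //; exact: ltW.
    have -> : u * x0 * u = u ^+ 2 * x0 by ring.
    rewrite u2; lra.
  have -> : - (lam ^+ 2 / 2) - 2 * lam - 1 = - (u ^+ 2 * (1 - x0) ^+ 2 / 2) - 4 * u * (1 - x0) - 7.
    by rewrite /lam; field.
  rewrite u2 /s.
  have : 4 * u * (1 - x0) <= 4 * u by apply: ler_piMr; lra.
  have : ell * x0 ^+ 2 <= ell * x0 / 2 by rewrite expr2; nra.
  have -> : 2 * ell * (1 - x0) ^+ 2 / 2 = ell - 2 * (ell * x0) + ell * x0 ^+ 2 by field.
  lra.
have Mq : 16 * ell <= M * expR (- (lam ^+ 2 / 2) - 2 * lam - 1).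
  apply: (@le_trans _ _ (M * expR (s - ell))); last first.
    by apply: ler_wpM2l; [exact: ltW|rewrite ler_expR].
  rewrite ME -expRD addrC subrK; apply: le_trans (expR_ge_sqr _); last first.
    by rewrite /s; lra.
  (* With [ell * x0 ^+ 2 >= 512] this is at least [64 * ell]. *)
  have -> : s ^+ 2 / 2 = ell * (ell * x0 ^+ 2) / 8 by rewrite /s; field.
  by nra.
by rewrite mulrBr; lra.
Qed.

End TiltedBound.

(** * Potentials of a section *)

(** After squaring, [1 + y <= expR y] reduces the claim to [(1 - 2 * tau) * (1 + 2 * tau + 8 * tau
    ^+ 2) >= 1]; the excess of the left side is [4 * tau ^+ 2 * (1 - 4 * tau)]. *)
Lemma chi2_mgf_le {R : realType} (tau : R) : 0 <= tau -> tau <= 4^-1 ->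
  (Num.sqrt (1 - 2 * tau))^-1 <= expR (tau + 4 * tau ^+ 2).
Proof.
move=> t0 t1.
have s0 : 0 < Num.sqrt (1 - 2 * tau) by rewrite sqrtr_gt0; lra.
rewrite -[X in _ <= X]invrK lef_pV2 ?posrE ?invr_gt0 ?expR_gt0// -expRN.
have -> : expR (- (tau + 4 * tau ^+ 2)) = Num.sqrt (expR (- (2 * tau + 8 * tau ^+ 2))).
  have -> : - (2 * tau + 8 * tau ^+ 2) = 2%:R * - (tau + 4 * tau ^+ 2) by ring.
  by rewrite expRM_natl sqrtr_sqr ger0_norm// expR_ge0.
apply: ler_wsqrtr; rewrite expRN.
have := expR_ge1Dx (2 * tau + 8 * tau ^+ 2).
have e0 := expR_gt0 (2 * tau + 8 * tau ^+ 2).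
rewrite -[_^-1]div1r ler_pdivrMr// => h.
apply: (@le_trans _ _ ((1 - 2 * tau) * (1 + (2 * tau + 8 * tau ^+ 2)))).
  have -> : (1 - 2 * tau) * (1 + (2 * tau + 8 * tau ^+ 2)) = 1 + 4 * tau ^+ 2 * (1 - 4 * tau) by ring.
  by rewrite lerDl mulr_ge0//; [rewrite mulr_ge0// sqr_ge0|lra].
by apply: ler_wpM2l => //; lra.
Qed.

Section Potentials.
Context {R : realType} {d : measure_display} {T : measurableType d}
  (P : probability T R) (X : nat -> T -> R) (n M L : nat) (sigma Rt : R)
  (Aent : 'I_n -> 'I_(M * L) -> T -> R).
Hypotheses (n_gt0 : (0 < n)%N) (M_gt0 : (0 < M)%N).
Hypothesis mX : forall i, measurable_fun setT (X i).
Hypothesis gd : gaussian_design_indep P X Aent.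
Local Notation controlled := (controlled P X Aent).

Definition partial_residual (l : nat) (w : T) : 'cV[R]_n :=
  sc_residual sigma Rt (design_matrix Aent w) (first_samples X n w) (take l (enum 'I_L)).

Lemma mem_take_enum (l : nat) (l' : 'I_L) : l' \in take l (enum 'I_L) -> (l' < l)%N.
Proof.
move=> h; have hs := index_ltn h.
by rewrite index_enum_ord in hs.
Qed.

(** In column-by-column order, the first [l] sections are exactly the entries of rank below
    [l * (M * n)]. *)
Lemma adapted_partial_residual l i :
  adapted X Aent (l * (M * n)) (fun w => partial_residual l w i 0).
Proof.
apply: (measurable_sc_residual (T := g_sigma_algebraType (past X Aent (l * (M * n))))).
- move=> i'; rewrite (_ : (fun w => _) = X i'); first exact: adapted_source.
  by apply/funext => w; rewrite mxE.
- move=> l' /mem_take_enum l'l i' k.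
  rewrite (_ : (fun w => _) = Aent i' (ordML l' k)); last by apply/funext => w; rewrite mxE.
  apply: adapted_entry => /=.
  apply: (@leq_trans ((l' * M + k).+1 * n)); first by rewrite mulSn addnC ltn_add2r.
  rewrite mulnA leq_mul2r; apply/orP; right.
  apply: (@leq_trans (l'.+1 * M)); last by rewrite leq_mul2r l'l orbT.
  by rewrite -addnS mulSn addnC leq_add2r.
Qed.

Definition direction (l : nat) (i : 'I_n) (w : T) : R := sc_dir (partial_residual l w) i.

Lemma adapted_direction l i : adapted X Aent (l * (M * n)) (direction l i).
Proof.
by apply: measurable_sc_dir => i'; exact: adapted_partial_residual.
Qed.

Lemma sum_direction_sqr l w : \sum_i direction l i w ^+ 2 = 1.
Proof. exact: sum_sc_dir_sqr. Qed.

Definition sec_score (l : 'I_L) (k : 'I_M) : T -> R :=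
  score Aent (ordML l k) (direction l).

Let col_index (l : 'I_L) (k : 'I_M) : (ordML l k * n = l * (M * n) + k * n)%N.
Proof. by rewrite /= mulnDl mulnA. Qed.

Let col_indexS (l : 'I_L) (k : 'I_M) : ((ordML l k).+1 * n = l * (M * n) + k.+1 * n)%N.
Proof. by rewrite mulSn col_index mulSn addnCA. Qed.

Section ScorePotential.
Variables (theta lam x0 t : R).
Hypotheses (theta0 : 0 <= theta) (theta1 : theta <= 4^-1) (lam0 : 0 <= lam)
  (lamtheta : lam * theta <= 1).

Definition score_potential (l : 'I_L) (w : T) : R :=
  expR (t * x0) + expR t * \prod_k tilted lam theta (sec_score l k w).

Definition score_rate : R := expR (t * x0) +
  expR t * expR (theta ^+ 2 / 2 - 2^-1 * expR (- (lam ^+ 2 / 2) - 2 * lam - 1)) ^+ M.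

Lemma controlled_tilted (l : 'I_L) (k : 'I_M) :
  controlled (l * (M * n) + k * n) (l * (M * n) + k.+1 * n)
    (expR (theta ^+ 2 / 2 - 2^-1 * expR (- (lam ^+ 2 / 2) - 2 * lam - 1)))
    (fun w => tilted lam theta (sec_score l k w)).
Proof.
rewrite -col_index -col_indexS.
apply: controlled_le (tilted_mgf_le theta0 theta1 lamtheta) _.
apply: controlled_exp_score => //; try exact: expR_ge0.
(* The direction is fixed when the section starts, hence is known before each of its columns is
   revealed. *)
- move=> i; have le_past : (l * (M * n) <= ordML l k * n)%N by rewrite col_index leq_addr.
  have := adapted_widen le_past (@adapted_direction l i); exact.
- exact: sum_direction_sqr.
- by move=> z; exact: tilted_ge0.
Qed.

Lemma controlled_score_potential (l : 'I_L) :
  controlled (0 + l * (M * n)) (0 + l.+1 * (M * n)) score_rate (score_potential l).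
Proof.
rewrite !add0n; apply: controlledD => //; first by apply: controlled_cst => //; exact: expR_ge0.
apply: controlledZ => //.
rewrite mulSn addnC; apply: controlled_prod => //.
by move=> k; exact: controlled_tilted.
Qed.

Lemma score_potential_tail c : 0 < c ->
  (P [set w | (c <= \prod_l score_potential l w)%R] <= (score_rate ^+ L / c)%:E)%E.
Proof.
move=> c0; apply: (controlled_markov mX gd) => //.
apply: controlled_prod => //; last by move=> l; exact: controlled_score_potential.
by rewrite /score_rate addr_ge0 ?mulr_ge0 ?exprn_ge0// ?expR_ge0.
Qed.

End ScorePotential.

Section NormPotential.
Variable tau : R.
Hypotheses (tau0 : 0 <= tau) (tau1 : tau <= 4^-1).

Definition norm_potential (l : 'I_L) (w : T) : R :=
  1 + \sum_k expR (- (tau * n%:R)) * expR (tau * n%:R * \sum_i Aent i (ordML l k) w ^+ 2).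

(** Each column contributes at most [expR (4 * tau ^+ 2) ^+ n] by [chi2_mgf_le]; the summand 1 is
    bounded by [M] such terms as well, whence the factor 2. *)
Lemma controlled_norm_potential (l : 'I_L) :
  controlled (0 + l * (M * n)) (0 + l.+1 * (M * n))
    (2 * M%:R * expR (4 * tau ^+ 2) ^+ n) (norm_potential l).
Proof.
have -> : 2 * M%:R * expR (4 * tau ^+ 2) ^+ n =
    M%:R * expR (4 * tau ^+ 2) ^+ n + M%:R * expR (4 * tau ^+ 2) ^+ n :> R by ring.
have e1 : 1 <= expR (4 * tau ^+ 2) :> R.
  by rewrite -[X in X <= _]expR0 ler_expR mulr_ge0// sqr_ge0.
apply: controlledD => //.
  apply: (controlled_le (kappa := 1)); last exact: controlled_cst.
  by rewrite -[X in X <= _]mulr1 ler_pM// ?ler1n// exprn_ege1.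
have -> : M%:R = (size (index_enum 'I_M))%:R :> R by rewrite -[index_enum _]enumT size_enum_ord.
apply: controlled_sum => // k.
apply: (controlled_widen (p := (ordML l k * n)%N) (q := ((ordML l k).+1 * n)%N)).
- by rewrite col_index leq_addr.
- by rewrite col_indexS [(l.+1 * _)%N]mulSn addnC leq_add2r leq_mul2r ltn_ord orbT.
apply: (controlled_le
  (kappa := expR (- (tau * n%:R)) * (Num.sqrt (1 - 2 * tau))^-1 ^+ n)).
  rewrite -mulNr expRM_natr -exprMn.
  apply: lerXn2r; rewrite ?nnegrE ?expR_ge0//.
  have -> : 4 * tau ^+ 2 = - tau + (tau + 4 * tau ^+ 2) by ring.
  by rewrite expRD; apply: ler_wpM2l; [exact: expR_ge0|exact: chi2_mgf_le].
have tau2 : tau < 2^-1 by apply: le_lt_trans tau1 _; rewrite ltf_pV2 ?posrE ?ltr_nat.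
apply: controlledZ => //.
by apply: controlled_col_sqr; last exact: tau2.
Qed.

Lemma norm_potential_tail c : 0 < c ->
  (P [set w | (c <= \prod_l norm_potential l w)%R] <=
   ((2 * M%:R * expR (4 * tau ^+ 2) ^+ n) ^+ L / c)%:E)%E.
Proof.
move=> c0; apply: (controlled_markov mX gd) => //.
apply: controlled_prod => //; last by move=> l; exact: controlled_norm_potential.
Qed.

End NormPotential.

End Potentials.

(** * One encoder step, bounded pathwise through the potentials *)

Section StepBound.
Context {R : realType} {d : measure_display} {T : measurableType d}
  (X : nat -> T -> R) (n M L : nat) (sigma Rt : R)
  (Aent : 'I_n -> 'I_(M * L) -> T -> R).
Hypotheses (n_gt0 : (0 < n)%N) (M_gt0 : (0 < M)%N).
Variables (u theta lam x0 t tau : R).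
Hypotheses (sigma0 : 0 < sigma) (u0 : 0 < u) (x00 : 0 < x0) (t0 : 0 < t)
  (u2E : u ^+ 2 = 2 * ln (M%:R : R)) (thetaE : M%:R * theta * u = t)
  (theta0 : 0 <= theta)
  (lamE : lam = u * (1 - x0) + 2) (lam0 : 0 <= lam) (tau0 : 0 <= tau)
  (rate : u ^+ 2 = n%:R * (2 * Rt / L%:R)) (rho1 : 2 * Rt / L%:R <= 1).
Let rho := 2 * Rt / L%:R.
Local Notation resid := (partial_residual X sigma Rt Aent).
Local Notation F := (score_potential X sigma Rt Aent theta lam x0 t).
Local Notation Phi := (norm_potential Aent tau).

Let nR_gt0 : 0 < n%:R :> R. Proof. by rewrite ltr0n. Qed.

(** If the shortfall exceeds [x0], the best score, and so every score, lies below [lam - 2]. The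
    relation [M%:R * theta * u = t] splits the exponential into [expR t] and [M] equal factors, each
    of which is dominated by [tilted] at a different score of the section. *)
Lemma score_potential_ge (l : 'I_L) (k : 'I_M) w :
  (forall k', sec_score X sigma Rt Aent l k' w <= sec_score X sigma Rt Aent l k w) ->
  expR (t * Num.max 0 (1 - sec_score X sigma Rt Aent l k w / u)) <= F l w.
Proof.
move=> kmax; rewrite /score_potential; set z := sec_score X sigma Rt Aent l k w.
have prod_ge0 : 0 <= \prod_k' tilted lam theta (sec_score X sigma Rt Aent l k' w).
  by apply: prodr_ge0 => k' _; exact: tilted_ge0.
have [xx0|xx0] := lerP (Num.max 0 (1 - z / u)) x0.
  by apply: ler_wpDr; [rewrite mulr_ge0// expR_ge0|rewrite ler_expR ler_pM2l].
have zlt : z < lam - 2.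
  move: xx0; rewrite lt_max ltNge (ltW x00)/= => xx0.
  rewrite lamE addrK mulrC -ltr_pdivrMr//; lra.
have -> : Num.max 0 (1 - z / u) = 1 - z / u.
  by move: xx0; rewrite /Num.max; case: ifP => // _; rewrite ltNge (ltW x00).
apply: ler_wpDl; first exact: expR_ge0.
have -> : t * (1 - z / u) = t + M%:R * (- theta * z).
  by rewrite -thetaE; field; rewrite gt_eqF.
rewrite expRD; apply: ler_wpM2l; first exact: expR_ge0.
rewrite expRM_natl.
have -> : expR (- theta * z) ^+ M = \prod_(k' < M) expR (- theta * z).
  by rewrite prodr_const card_ord.
apply: ler_prod => k' _; rewrite expR_ge0/=.
apply: le_trans (tilted_ge _ _); last by apply: le_trans (kmax k') _; exact: ltW.
by rewrite ler_expR !mulNr lerN2 ler_wpM2l.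
Qed.

Lemma norm_potential_ge (l : 'I_L) (k : 'I_M) w :
  expR (tau * n%:R * Num.max 0 (\sum_i Aent i (ordML l k) w ^+ 2 - 1)) <= Phi l w.
Proof.
set S := \sum_i _; rewrite /norm_potential.
have term_ge0 k' : 0 <= expR (- (tau * n%:R)) *
    expR (tau * n%:R * \sum_i Aent i (ordML l k') w ^+ 2).
  by rewrite mulr_ge0// expR_ge0.
rewrite /Num.max; case: ifP => _.
  apply: ler_wpDl => //; rewrite (bigD1 k)//=.
  apply: ler_wpDr; first by apply: sumr_ge0 => k' _.
  by rewrite -expRD ler_expR -/S mulrBr mulr1 addrC.
by rewrite mulr0 expR0; apply: ler_wpDr => //; apply: sumr_ge0.
Qed.

Lemma sc_coefE l : sc_coef M L sigma Rt l = u * sigma * Num.sqrt (1 - rho) ^+ l.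
Proof.
rewrite /sc_coef -u2E -/rho sqrtrM; last by rewrite mulr_ge0// sqr_ge0.
rewrite -exprMn sqrtr_sqr ger0_norm; last by rewrite mulr_ge0// ltW.
congr (_ * _); elim: l => [|l IH]; first by rewrite !expr0 sqrtr1.
by rewrite !exprS sqrtrM ?IH// subr_ge0.
Qed.

(** The pair [xg] holds the score shortfall and the norm excess of the selected column. The
    recursion is the expansion of the squared norm of the new residual, with the score replaced by a
    lower bound and the column norm by an upper bound. *)
Lemma residual_step (l : nat) w : exists xg : R * R,
  [/\ 0 <= xg.1, 0 <= xg.2 & forall lL : (l < L)%N,
    [/\ expR (t * xg.1) <= F (Ordinal lL) w,
        expR (tau * n%:R * xg.2) <= Phi (Ordinal lL) w &
        enorm (resid l.+1 w) ^+ 2 <= enorm (resid l w) ^+ 2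
          - 2 * rho * (Num.sqrt n%:R * sigma * Num.sqrt (1 - rho) ^+ l) *
            enorm (resid l w) * (1 - xg.1)
          + rho * (Num.sqrt n%:R * sigma * Num.sqrt (1 - rho) ^+ l) ^+ 2 * (1 + xg.2)]].
Proof.
(* Past the last section the noises are set to zero, so that they form sequences indexed by all
   naturals. *)
case: (pselect (l < L)%N) => [lL|nL]; last by exists (0, 0); split.
pose o := Ordinal lL; set r := resid l w; set A := design_matrix Aent w.
have -> : resid l.+1 w = sc_residual sigma Rt A (first_samples X n w)
    (rcons (take l (enum 'I_L)) o).
  rewrite /partial_residual (take_nth o) ?size_enum_ord//.
  by rewrite (_ : nth o (enum 'I_L) l = o)//; exact: (nth_ord_enum o o).
have [b ->] := sc_residual_rcons sigma Rt A (first_samples X n w) (take l (enum 'I_L)) o.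
have [k [kmax ->]] := sc_step_max sigma Rt A r b o M_gt0.
pose z k' := sec_score X sigma Rt Aent o k' w.
have zE k' : z k' = Num.sqrt n%:R * \sum_i A i (ordML o k') * sc_dir r i.
  rewrite /z /sec_score /score mulr_sumr; apply: eq_bigr => i _.
  by rewrite mxE mulrA.
have sqn : Num.sqrt n%:R ^+ 2 = n%:R :> R by rewrite sqr_sqrtr// ltW.
have sqn0 : 0 < Num.sqrt n%:R :> R by rewrite sqrtr_gt0.
set S := \sum_i Aent i (ordML o k) w ^+ 2.
(* For a zero residual the encoder's scores all vanish, so the selected column need not maximise the
   scores along [sc_dir]; the shortfall can be set to 0, as the linear term of the recursion
   vanishes too. *)
set x := if enorm r == 0 then 0 else Num.max 0 (1 - z k / u).
have x_ge0 : 0 <= x by rewrite /x; case: ifP => // _; rewrite le_max lexx.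
exists (x, Num.max 0 (S - 1)); split => //=; first by rewrite le_max lexx.
move=> lL'; have -> : Ordinal lL' = o by apply: val_inj.
split.
- rewrite /x; case: eqP => [_|/eqP r0].
    rewrite mulr0 expR0 /score_potential; apply: ler_wpDr.
      rewrite mulr_ge0 ?expR_ge0//; apply: prodr_ge0 => k' _; exact: tilted_ge0.
    by rewrite -[X in X <= _]expR0 ler_expR mulr_ge0// ltW.
  apply: score_potential_ge => k'; rewrite -/(z k') -/(z k).
  have := kmax k'; rewrite !sc_scoreE//.
  have zS k'' : z k'' = \sum_i (Num.sqrt n%:R * A i (ordML o k'')) * sc_dir r i.
    by rewrite zE mulr_sumr; apply: eq_bigr => i _; rewrite mulrA.
  by rewrite -!zS.
- exact: norm_potential_ge.
- rewrite enorm_sub_scale_sqr -/r.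
  have -> : \sum_i col (ordML o k) A i 0 ^+ 2 = S.
    by apply: eq_bigr => i _; rewrite !mxE.
  have -> : \sum_i col (ordML o k) A i 0 * sc_dir r i = z k / Num.sqrt n%:R.
    rewrite zE mulrAC divff ?gt_eqF// mul1r; apply: eq_bigr => i _; by rewrite !mxE.
  rewrite sc_coefE; set kp := Num.sqrt (1 - rho) ^+ l.
  have kp0 : 0 <= kp by rewrite exprn_ge0// sqrtr_ge0.
  (* The rate condition in the form [u ^+ 2 = n * rho] matches the section coefficients with the
     decay of the target distortion. *)
  have uE : u ^+ 2 = Num.sqrt n%:R ^+ 2 * rho by rewrite sqn.
  apply: lerD.
    rewrite lerD2l lerN2.
    have [r0|r0] := eqVneq (enorm r) 0; first by rewrite r0 !(mulr0, mul0r).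
    have zx : u * (1 - x) <= z k.
      rewrite /x (negbTE r0) mulrC -ler_pdivlMr//.
      have : 1 - z k / u <= Num.max 0 (1 - z k / u) by rewrite le_max lexx orbT.
      lra.
    have -> : 2 * rho * (Num.sqrt n%:R * sigma * kp) * enorm r * (1 - x) =
      (2 * sigma * kp * enorm r * u / Num.sqrt n%:R) * (u * (1 - x)).
      transitivity (2 * sigma * kp * enorm r * u ^+ 2 / Num.sqrt n%:R * (1 - x)).
        by rewrite uE; field; rewrite gt_eqF.
      by ring.
    have -> : 2 * (u * sigma * kp) * enorm r * (z k / Num.sqrt n%:R) =
      (2 * sigma * kp * enorm r * u / Num.sqrt n%:R) * z k by ring.
    apply: ler_wpM2l => //; apply: divr_ge0; last exact: ltW.
    by rewrite !mulr_ge0// ?enorm_ge0// ltW.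
  have -> : rho * (Num.sqrt n%:R * sigma * kp) ^+ 2 = (u * sigma * kp) ^+ 2.
    rewrite !exprMn uE; ring.
  apply: ler_wpM2l; first exact: sqr_ge0.
  have : S - 1 <= Num.max 0 (S - 1) by rewrite le_max lexx orbT.
  lra.
Qed.

End StepBound.

(** * Choice of constants *)

Section TailConstants.
Context {R : realType}.

(** As [tau <= d1 / 8], the moment exponent [4 * tau ^+ 2] uses at most half of [tau * d1]; the
    other half, times [L], pays for [2 * Rt], coming from [(2 * M) ^+ L] through the rate condition,
    and for [d1 ^+ 2 / 8]. *)
Lemma norm_tail_le (M L n : nat) (Rt d1 tau : R) : (2 <= M)%N -> (0 < L)%N ->
  L%:R * ln (M%:R : R) = n%:R * Rt -> 0 <= tau -> tau <= d1 / 8 ->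
  4 * Rt + d1 ^+ 2 / 4 <= L%:R * (tau * d1) ->
  (2 * M%:R * expR (4 * tau ^+ 2) ^+ n) ^+ L / expR (tau * n%:R * (L%:R * d1)) <=
  2 * (M * L)%:R * expR (- (n%:R * d1 ^+ 2) / 8).
Proof.
move=> M2 L0 rate tau0 tau1 L_large.
have M0 : 0 < M%:R :> R by rewrite ltr0n (leq_trans _ M2).
have twoM : 2 * M%:R <= expR (2 * ln (M%:R : R)).
  rewrite expRM_natl lnK ?posrE// expr2 ler_pM2r// ler_nat//.
have nn : 0 <= n%:R :> R by exact: ler0n.
have LL : 0 <= L%:R :> R by exact: ler0n.
apply: (@le_trans _ _ (expR (- (n%:R * d1 ^+ 2) / 8))); last first.
  rewrite ler_peMl ?expR_ge0// -[2]/(2%:R) -natrM ler1n !muln_gt0/= L0 andbT.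
  exact: leq_trans M2.
rewrite ler_pdivrMr ?expR_gt0// -expRD.
apply: (@le_trans _ _ (expR (2 * ln (M%:R : R) + n%:R * (4 * tau ^+ 2)) ^+ L)).
  apply: lerXn2r; rewrite ?nnegrE ?expR_ge0//.
  by rewrite expRD [expR (n%:R * _)]expRM_natl; apply: ler_wpM2r => //; rewrite exprn_ge0// expR_ge0.
rewrite -expRM_natl ler_expR mulrDr mulrCA rate.
have tau4 : 4 * tau ^+ 2 <= tau * d1 / 2 by rewrite expr2; nra.
have : n%:R * L%:R * (4 * tau ^+ 2) <= n%:R * L%:R * (tau * d1 / 2).
  by apply: ler_wpM2l => //; exact: mulr_ge0.
have : n%:R * (4 * Rt + d1 ^+ 2 / 4) <= n%:R * (L%:R * (tau * d1)) by exact: ler_wpM2l.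
lra.
Qed.

(** Since [x0 <= d2 / 2], at least half of the exponent [4 * ell * d2] survives, which is the power
    [2 * d2] of [M]. The strict inequality comes from 2 being less than [8 * ell]. *)
Lemma score_tail_lt (M L : nat) (q x0 d2 : R) (ell := ln (M%:R : R)) : (0 < L)%N ->
  (0 < M)%N -> 1 <= ell -> x0 <= d2 / 2 -> 0 <= q -> q <= 2 * expR (4 * ell * x0) ->
  q ^+ L / expR (4 * ell * (L%:R * d2)) <
  (8 * ell / powR (M%:R : R) (2 * d2)) ^+ L.
Proof.
move=> L0 M0 ell1 x0d q0 q_le.
have -> : expR (4 * ell * (L%:R * d2)) = expR (4 * ell * d2) ^+ L.
  by rewrite -expRM_natl mulrCA.
rewrite -expr_div_n ltr_pXn2r// ?nnegrE; last 2 first.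
- by rewrite divr_ge0// expR_ge0.
- by rewrite divr_ge0 ?powR_ge0//; lra.
have -> : powR (M%:R : R) (2 * d2) = expR (2 * d2 * ell).
  by rewrite /powR pnatr_eq0 gtn_eqF.
apply: (@le_lt_trans _ _ (2 / expR (2 * d2 * ell))).
  rewrite ler_pdivrMr ?expR_gt0// mulrAC -mulrA -expRB.
  apply: le_trans q_le _; rewrite ler_pM2l// ler_expR; nra.
by rewrite ltr_pM2r ?invr_gt0 ?expR_gt0//; lra.
Qed.

Lemma prod_expR_lt (L : nat) (c : R) (x f : 'I_L -> R) b :
  0 < c -> (forall l, expR (c * x l) <= f l) -> \prod_l f l < expR (c * b) ->
  \sum_l x l <= b.
Proof.
move=> c0 xf fb; rewrite -(ler_pM2l c0) -ler_expR ltW//.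
apply: le_lt_trans fb; rewrite mulr_sumr expR_sum.
by apply: ler_prod => l _; rewrite expR_ge0/=.
Qed.

End TailConstants.

(** * The distortion bound on the good event *)

Section Final.
Context {R : realType} {d : measure_display} {T : measurableType d}
  (X : nat -> T -> R) (n M L : nat) (sigma Rt d0 d1 d2 x0 tau : R)
  (Aent : 'I_n -> 'I_(M * L) -> T -> R).
Hypotheses (sigma0 : 0 < sigma) (Rt0 : 0 < Rt) (d00 : 0 < d0) (d10 : 0 < d1)
  (d20 : 0 < d2) (n_gt0 : (0 < n)%N) (M_gt0 : (0 < M)%N) (L_gt0 : (0 < L)%N)
  (rate : L%:R * ln (M%:R : R) = n%:R * Rt)
  (x00 : 0 < x0) (x01 : x0 <= 2^-1) (ell_large : 512 <= ln (M%:R : R) * x0 ^+ 2)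
  (tau0 : 0 < tau)
  (L16 : 16 * Rt <= L%:R) (L16b : 16 * Rt ^+ 2 <= L%:R)
  (Ld0 : 8 * Rt * d0 <= L%:R * (d1 + d2)).

Let ell := ln (M%:R : R).
Let u := Num.sqrt (2 * ell).
Let theta := 4 * ell / (M%:R * u).
Let lam := u * (1 - x0) + 2.
Let t := 4 * ell.
Local Notation F := (score_potential X sigma Rt Aent theta lam x0 t).
Local Notation Phi := (norm_potential Aent tau).

(** The source norm bounds the initial excess by [d0], and the two product bounds limit the total
    noises to [L%:R * d2] and [L%:R * d1]. [drift_recursion] propagates these, and [rate_constants]
    evaluates the outcome. *)
Lemma distortion_le w :
  `| enorm (first_samples X n w) / (Num.sqrt n%:R * sigma) - 1 | <= d0 ->
  \prod_l F l w < expR (t * (L%:R * d2)) ->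
  \prod_l Phi l w < expR (tau * n%:R * (L%:R * d1)) ->
  n%:R^-1 * enorm (first_samples X n w -
     design_matrix Aent w *m sc_beta sigma Rt (design_matrix Aent w) (first_samples X n w)) ^+ 2
  <= sigma ^+ 2 * expR (- (2 * Rt)) * (1 + expR Rt * (d0 + 5 * Rt * (d1 + d2))) ^+ 2.
Proof.
move=> hs hF hPhi.
have nR0 : 0 < n%:R :> R by rewrite ltr0n.
have LR0 : 0 < L%:R :> R by rewrite ltr0n.
have MR0 : 0 < M%:R :> R by rewrite ltr0n.
have ell0 : 0 < ell by rewrite -(@pmulr_lgt0 _ (x0 ^+ 2)) ?exprn_gt0//; apply: lt_le_trans ell_large; rewrite ltr0n.
have u0 : 0 < u by rewrite sqrtr_gt0; lra.
have u2E : u ^+ 2 = 2 * ell by rewrite sqr_sqrtr//; lra.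
have ME : M%:R = expR ell by rewrite lnK.
have [th0 th1 lam0 lamth _] := tilted_constants x00 x01 ell_large ME u0 u2E.
have t0 : 0 < t by rewrite /t; lra.
have thE : M%:R * theta * u = t by rewrite /theta /t; field; rewrite !gt_eqF.
have urate : u ^+ 2 = n%:R * (2 * Rt / L%:R).
  rewrite u2E; have -> : ell = n%:R * Rt / L%:R by rewrite -rate mulrC mulKf ?gt_eqF.
  by field; rewrite gt_eqF.
have [rho0 rho1 arho Cle Ple] := @rate_constants _ Rt d0 d1 d2 L%:R L Rt0 d00 d10 d20 erefl
  LR0 L16 L16b Ld0.
have rho_1 : 2 * Rt / L%:R <= 1 by lra.
have [xg xgP] := choice (fun l => residual_step X Aent n_gt0 M_gt0 tau sigma0 u0 x00 t0
  u2E thE th0 erefl lam0 urate rho_1 l w).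
pose V l := enorm (partial_residual X sigma Rt Aent l w).
set q := Num.sqrt n%:R * sigma.
have sn0 : 0 < Num.sqrt n%:R :> R by rewrite sqrtr_gt0.
have q0 : 0 < q by rewrite mulr_gt0.
set rho := 2 * Rt / L%:R in rho0 rho1 arho Cle Ple rho_1 xgP *.
set a := rho / (1 - rho) in arho Cle.
have V0le : V 0%N <= q * (1 + d0).
  have -> : V 0%N = enorm (first_samples X n w) by rewrite /V /partial_residual take0.
  rewrite mulrC -ler_pdivrMr//.
  by move: hs; rewrite ler_norml -/q; lra.
have key := @drift_recursion _ rho a q d0 L V (fun l => (xg l).1) (fun l => (xg l).2)
  rho0 rho1 arho q0 (ltW d00) (fun l => enorm_ge0 _)
  (fun l => let: And3 h _ _ := xgP l in h) (fun l => let: And3 _ h _ := xgP l in h) V0le.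
have {key}key := key (fun l lL => let: And3 _ _ h := xgP l in let: And3 _ _ h' := h lL in h').
have sumx : \sum_(l < L) (xg l).1 <= L%:R * d2.
  apply: (prod_expR_lt t0 _ hF) => -[l lL].
  by have [_ _ /(_ lL)[]] := xgP l.
have sumg : \sum_(l < L) (xg l).2 <= L%:R * d1.
  apply: (prod_expR_lt _ _ hPhi); first exact: mulr_gt0.
  by move=> [l lL]; have [_ _ /(_ lL)[]] := xgP l.
have a0 : 0 <= a by rewrite -(@pmulr_lge0 _ (1 - rho)) ?arho; lra.
set Del := d0 + _; have Del0 : 0 <= Del.
  rewrite /Del addr_ge0//; first exact: ltW.
  by apply: mulr_ge0; [apply: mulr_ge0 => //; exact: ltW|apply: addr_ge0; exact: ltW].
have sum_le : \sum_(l < L) ((xg l).1 + (xg l).2 / 2) <= L%:R * (d2 + d1 / 2).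
  by rewrite big_split/= -mulr_suml mulrDr; lra.
have VL : V L <= q * Num.sqrt (1 - rho) ^+ L * (1 + expR Rt * Del).
  apply: le_trans key _; apply: ler_wpM2l.
    by rewrite mulr_ge0 ?exprn_ge0 ?sqrtr_ge0// ltW.
  rewrite lerD2l; apply: le_trans Cle; apply: ler_wpM2l; first by apply: exprn_ge0; lra.
  by rewrite lerD2l; apply: ler_wpM2l.
rewrite residual_sc_beta.
have -> : enorm (sc_residual sigma Rt (design_matrix Aent w) (first_samples X n w) (enum 'I_L)) = V L.
  by rewrite /V /partial_residual take_oversize// size_enum_ord.
rewrite mulrC ler_pdivrMr//.
have D0 : 0 <= 1 + expR Rt * Del by rewrite addr_ge0// mulr_ge0// expR_ge0.
apply: (@le_trans _ _ ((q * Num.sqrt (1 - rho) ^+ L * (1 + expR Rt * Del)) ^+ 2)).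
  apply: lerXn2r; rewrite ?nnegrE//; first exact: enorm_ge0.
  by rewrite !mulr_ge0 ?exprn_ge0 ?sqrtr_ge0// ltW.
have -> : (q * Num.sqrt (1 - rho) ^+ L * (1 + expR Rt * Del)) ^+ 2 =
    sigma ^+ 2 * (1 - rho) ^+ L * (1 + expR Rt * Del) ^+ 2 * n%:R.
  rewrite /q !exprMn -exprM mulnC exprM sqr_sqrtr; last exact: ltW.
  rewrite sqr_sqrtr; last by lra.
  by ring.
apply: ler_wpM2r; first exact: ltW.
by apply: ler_wpM2r; [exact: sqr_ge0|apply: ler_wpM2l => //; exact: sqr_ge0].
Qed.

(** By the last part of [tilted_constants], the second summand of [score_rate] is at most 1, hence
    at most [expR (t * x0)]. *)
Lemma score_rate_le : score_rate M theta lam x0 t <= 2 * expR (t * x0).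
Proof.
have MR0 : 0 < M%:R :> R by rewrite ltr0n.
have ell0 : 0 < ell by rewrite -(@pmulr_lgt0 _ (x0 ^+ 2)) ?exprn_gt0//; apply: lt_le_trans ell_large; rewrite ltr0n.
have u0 : 0 < u by rewrite sqrtr_gt0; lra.
have u2E : u ^+ 2 = 2 * ell by rewrite sqr_sqrtr//; lra.
have ME : M%:R = expR ell by rewrite lnK.
have [_ _ _ _ le0] := tilted_constants x00 x01 ell_large ME u0 u2E.
rewrite /score_rate -expRM_natl -expRD [X in _ <= X]mulr_natl [X in _ <= X]mulr2n lerD2l ler_expR.
by apply: le_trans le0 _; apply: mulr_ge0; [rewrite /t mulr_ge0// ltW|exact: ltW].
Qed.

End Final.

(** * Thresholds for [M] and [L], and the union bound *)

Lemma natr_ge_bound {R : realType} (c : R) : exists N : nat, forall k, (N <= k)%N -> c <= k%:R.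
Proof.
exists (Num.bound `|c|) => k Nk; apply: le_trans (ler_norm c) _.
by apply: ltW; apply: lt_le_trans (archi_boundP (normr_ge0 c)) _; rewrite ler_nat.
Qed.

Unset Implicit Arguments.

Theorem mainTheorem11 (R : realType) (d : measure_display) (T : measurableType d)
    (P : probability T R) (X : nat -> T -> R) (sigma Rt d0 d1 d2 : R) :
  0 < sigma -> ergodic_source P X sigma ->
  0 < Rt ->
  0 < d0 -> 0 < d1 -> 0 < d2 ->
  d0 + 5 * Rt * (d1 + d2) < 2^-1 ->
  exists M0 L0 : nat, forall M L n : nat,
    (M0 <= M)%N -> (L0 <= L)%N ->
    L%:R * ln (M%:R : R) = n%:R * Rt ->
    forall Aent : 'I_n -> 'I_(M * L) -> T -> R,
      gaussian_design_indep P X Aent ->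
      let Delta := d0 + 5 * Rt * (d1 + d2) in
      let s := first_samples X n in
      let A := design_matrix Aent in
      let p0 := P [set w | d0 < `| enorm (s w) / (Num.sqrt (n%:R) * sigma) - 1 |] in
      let p1 := 2 * (M * L)%:R * expR (- (n%:R * d1 ^+ 2) / 8) in
      let p2 := (8 * ln (M%:R : R) / powR (M%:R) (2 * d2)) ^+ L in
      (P [set w | (sigma ^+ 2 * expR (- (2 * Rt)) * (1 + expR Rt * Delta) ^+ 2 <
                  n%:R^-1 * enorm (s w - A w *m sc_beta sigma Rt (A w) (s w)) ^+ 2)%R]
       < p0 + (p1 + p2)%:E)%E.
Proof.
move=> sigma0 [mX _ _ _ _] Rt0 d00 d10 d20 _.
(* Shortfalls up to [x0] are tolerated in every section; the bound [d2 / 2] leaves half of the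
   budget [d2] for the Chernoff estimate. *)
pose x0 := Num.min (d2 / 2) 2^-1.
have x00 : 0 < x0 by rewrite lt_min; apply/andP; split; lra.
have x01 : x0 <= 2^-1 by rewrite ge_min lexx orbT.
have x0d : x0 <= d2 / 2 by rewrite ge_min lexx.
(* [4^-1] is the range of [chi2_mgf_le], and [d1 / 8] is what [norm_tail_le] requires. *)
pose tau := Num.min 4^-1 (d1 / 8).
have tau0 : 0 < tau by rewrite lt_min; apply/andP; split; lra.
have tau1 : tau <= 4^-1 by rewrite ge_min lexx.
have taud : tau <= d1 / 8 by rewrite ge_min lexx orbT.
(* This threshold amounts to [ln M * x0 ^+ 2 >= 512], as required by [tilted_constants]. *)
have [M0 hM0] := natr_ge_bound (expR (512 / x0 ^+ 2)).
(* All summands are positive, so every lower bound on [L] holds at once; the leading 1 keeps [L]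
   positive. *)
have [L0 hL0] := natr_ge_bound (1 + 16 * Rt + 16 * Rt ^+ 2 + 8 * Rt * d0 / (d1 + d2) +
  (4 * Rt + d1 ^+ 2 / 4) / (tau * d1)).
exists M0, L0 => M L n leM leL rate Aent gd.
have M_large := hM0 _ leM; have L_large := hL0 _ leL.
lazy zeta; set s := first_samples X n; set A := design_matrix Aent.
have x02 : 0 < x0 ^+ 2 by rewrite exprn_gt0.
have MR0 : 0 < M%:R :> R by apply: lt_le_trans M_large; exact: expR_gt0.
have M_gt0 : (0 < M)%N by rewrite -(ltr0n R).
have ell_large : 512 <= ln (M%:R : R) * x0 ^+ 2.
  by rewrite -ler_pdivrMr// -ler_expR lnK.
have ell1 : 512 <= ln (M%:R : R).
  have : x0 ^+ 2 <= 1 by rewrite expr2; nra.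
  by nra.
have M2 : (2 <= M)%N.
  rewrite ltnNge; apply/negP => M1; have : M = 1%N by apply/eqP; rewrite eqn_leq M1.
  by move=> M1E; move: ell1; rewrite M1E ln1; lra.
have Rt2 : 0 < Rt ^+ 2 by rewrite exprn_gt0.
have h1 : 0 < 8 * Rt * d0 / (d1 + d2) by rewrite divr_gt0 ?mulr_gt0//; lra.
have h2 : 0 < (4 * Rt + d1 ^+ 2 / 4) / (tau * d1).
  by rewrite divr_gt0 ?mulr_gt0//; have := exprn_gt0 2 d10; lra.
have LR0 : 0 < L%:R :> R by lra.
have L_gt0 : (0 < L)%N by rewrite -(ltr0n R).
have n_gt0 : (0 < n)%N.
  rewrite lt0n; apply/eqP => n0; move: rate; rewrite n0 mul0r => /eqP.
  by rewrite mulf_eq0 !gt_eqF//; lra.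
have L16 : 16 * Rt <= L%:R by lra.
have L16b : 16 * Rt ^+ 2 <= L%:R by lra.
have Ld0 : 8 * Rt * d0 <= L%:R * (d1 + d2) by rewrite -ler_pdivrMr; lra.
have Ltau : 4 * Rt + d1 ^+ 2 / 4 <= L%:R * (tau * d1).
  by rewrite -ler_pdivrMr ?mulr_gt0//; lra.
set ell := ln (M%:R : R) in ell_large ell1.
set u := Num.sqrt (2 * ell).
set theta := 4 * ell / (M%:R * u).
set lam := u * (1 - x0) + 2.
set t := 4 * ell.
have u0 : 0 < u by rewrite sqrtr_gt0; lra.
have u2E : u ^+ 2 = 2 * ell by rewrite sqr_sqrtr//; lra.
have ME : M%:R = expR ell by rewrite lnK.
have [th0 th1 lam0 lamth _] := tilted_constants x00 x01 ell_large ME u0 u2E.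
pose S0 := [set w | d0 < `| enorm (s w) / (Num.sqrt (n%:R) * sigma) - 1 |].
pose S1 := [set w | expR (tau * n%:R * (L%:R * d1)) <= \prod_l norm_potential Aent tau l w].
pose S2 := [set w | expR (t * (L%:R * d2)) <=
  \prod_l score_potential X sigma Rt Aent theta lam x0 t l w].
have mbool (f : T -> bool) : measurable_fun setT f -> measurable [set w | f w].
  move=> mf; have := mf measurableT [set true] I; rewrite setTI.
  by rewrite (_ : f @^-1` [set true] = [set w | f w]).
have ms i : measurable_fun setT (fun w => s w i 0).
  by rewrite (_ : (fun w => _) = X i)//; apply/funext => w; rewrite mxE.
have mA i j : measurable_fun setT (fun w => A w i j).
  by rewrite (_ : (fun w => _) = Aent i j); [exact: gd.1|apply/funext => w; rewrite mxE].
have mS0 : measurable S0.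
  apply: mbool; apply: measurable_fun_ltr; first exact: measurable_cst.
  apply: measurableT_comp => //; apply: measurable_funB => //; apply: measurable_funM => //.
  exact: measurable_enorm.
have mphi (f : 'I_L -> T -> R) K kap c :
    (forall l : 'I_L, controlled P X Aent (0 + l * K) (0 + l.+1 * K) kap (f l)) ->
    measurable [set w | c <= \prod_l f l w].
  move=> Hf; apply: mbool; apply: measurable_fun_ler; first exact: measurable_cst.
  apply: measurable_prod => l _; have [_ mf _] := Hf l.
  exact: adapted_measurable mX gd _ _ mf.
have mS1 : measurable S1 by exact: mphi (controlled_norm_potential n_gt0 M_gt0 mX gd (ltW tau0) tau1).
have mS2 : measurable S2 by exact: mphi (controlled_score_potential sigma Rt n_gt0 mX gd x0 t th0 th1 lam0 lamth).
set Fail := [set w | _].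
have mFail : measurable Fail.
  apply: mbool; apply: measurable_fun_ltr; first exact: measurable_cst.
  apply: measurable_funM; first exact: measurable_cst.
  apply: measurable_funX.
  rewrite (_ : (fun w => _) = (fun w => enorm (sc_residual sigma Rt (A w) (s w) (enum 'I_L)))).
    by apply: measurable_enorm => i; apply: measurable_sc_residual => // l _ i' k; exact: mA.
  by apply/funext => w; rewrite residual_sc_beta.
(* Outside the three bad events [distortion_le] applies, so failure is contained in their union. *)
have sub : Fail `<=` S0 `|` (S1 `|` S2).
  move=> w; apply: contraPP => /not_orP[nS0 /not_orP[nS1 nS2]].
  rewrite /Fail/=; apply/negP; rewrite -leNgt.
  apply: (distortion_le (x0 := x0) (tau := tau)) => //.
  - by rewrite leNgt; apply/negP.
  - by rewrite ltNge; apply/negP.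
  - by rewrite ltNge; apply/negP.
have PFail : (P Fail <= P S0 + (P S1 + P S2))%E.
  apply: (@le_trans _ _ (P (S0 `|` (S1 `|` S2)))).
    by apply: le_measure; rewrite ?inE//; repeat apply: measurableU.
  apply: le_trans (measureU2 _ _ _) _ => //; first exact: measurableU.
  by apply: leeD => //; exact: measureU2.
apply: le_lt_trans PFail _.
(* The event [S0] gives [p0] exactly and the norm tail a weak inequality; strictness comes from the
   score tail and survives addition because the other probabilities are finite. *)
rewrite EFinD; apply: lee_ltD => //; first exact: fin_num_measure.
apply: lee_ltD; first exact: fin_num_measure.
- apply: le_trans (norm_potential_tail n_gt0 M_gt0 mX gd (ltW tau0) tau1 (expR_gt0 _)) _.
  by rewrite lee_fin; exact: norm_tail_le (ltW tau0) taud Ltau.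
- apply: le_lt_trans (score_potential_tail sigma Rt n_gt0 mX gd x0 t th0 th1 lam0 lamth (expR_gt0 _)) _.
  rewrite lte_fin; apply: score_tail_lt x0d _ _ => //; first by apply: le_trans ell1; rewrite ler1n.
    by rewrite /score_rate addr_ge0 ?mulr_ge0 ?exprn_ge0// ?expR_ge0.
  exact: score_rate_le.
Qed.
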